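(* Let $\succeq\,\in\{\ge,>\}$ be a relation symbol and let $\varphi\in\mathrm{Fml}_B^{\succeq}(\mathcal L_D)$ be a bounded $\succeq$-pure formula. Then: (i) if $\succeq$ is $>$, then $\varphi$ is $\forall$-robust relative to all domains $D$ of $\varphi$; (ii) if $\succeq$ is $\ge$, then $\varphi$ is $\exists$-robust relative to all domains $D$ of $\varphi$.
   Context: DIFFERENTIAL DYNAMIC LOGIC (dL), continuous fragment. Terms are built from real variables, rational constants, $+$, $\cdot$ and function symbols. Formulas are built from comparisons $p\sim q$ ($\sim\in\{=,\neq,\ge,>,\le,<\}$) by $\wedge,\vee,\neg,\to$, quantifiers over $\mathbb R$, and modalities $[x'=f(x)\&Q]P$ and $\langle x'=f(x)\&Q\rangle P$, where $x$ is a vector of variables, $f$ a vector of terms, $Q$ a formula of first-order real arithmetic (omitted $Q$ means true). Let $\Phi_\omega:[0,\tau_{\max})\to$ states be the right-maximal solution of $x'=f(x)$ from state $\omega$. Then $\omega\models[x'=f(x)\&Q]P$ iff $\Phi_\omega(\tau)\models P$ for all $\tau\in[0,\tau_{\max})$ such that $\Phi_\omega(\xi)\models Q$ for all $\xi\in[0,\tau]$; and $\omega\models\langle x'=f(x)\&Q\rangle P$ iff $\Phi_\omega(\tau)\models P$ for some such $\tau$. Valid means true in all states. ''Provable in dL'' means derivable in the classical first-order sequent calculus (with cut) extended by the following, where $\alpha$ is an ODE, $y$ is fresh: ($\mathbb R$) every sequent valid in first-order real arithmetic; $\langle\alpha\rangle P\leftrightarrow\neg[\alpha]\neg P$; $\langle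 x'=f(x)\rangle p(x)\leftrightarrow\exists t{\ge}0\,p(y(t))$ if $y(\cdot)$ is a (term-expressible) solution of $y'=f(y)$, $y(0)=x$; $\langle x'=f(x)\&Q\rangle\exists y\,P\leftrightarrow\exists y\langle x'=f(x)\&Q\rangle P$; (K) $[\alpha](P\to R)\to([\alpha]P\to[\alpha]R)$; (V) $P\to[\alpha]P$ if no free variable of $P$ is bound by $\alpha$; (G) from $\vdash P$ infer $\Gamma\vdash[\alpha]P$; (dW) from $Q\vdash P$ infer $\Gamma\vdash[x'=f(x)\&Q]P$; (dI) from $\Gamma,Q\vdash p\succeq q$ and $Q\vdash\dot p\ge\dot q$ infer $\Gamma\vdash[x'=f(x)\&Q]\,p\succeq q$ ($\succeq\in\{\ge,>\}$, dot = Lie derivative along $f$); (dC) from $\Gamma\vdash[x'=f(x)\&Q]C$ and $\Gamma\vdash[x'=f(x)\&Q\wedge C]P$ infer $\Gamma\vdash[x'=f(x)\&Q]P$; (DG) $[x'=f(x)\&Q(x)]P(x)\leftrightarrow\exists y[x'=f(x),y'=a(x)y+b(x)\&Q(x)]P(x)$; (DGi) $[x'=f(x)\&Q(x)]P(x)\to\forall y[x'=f(x),y'=g(x,y)\&Q(x)]P(x)$; (DX) $[x'=f(x)\&Q]P\leftrightarrow(Q\to P\wedge[x'=f(x)\&Q]P)$; (Uniq) $\langle x'=f(x)\&Q_1\wedge Q_2\rangle P\leftrightarrow\langle x'=f(x)\&Q_1\rangle P\wedge\langle x'=f(x)\&Q_2\rangle P$; (Cont) $x=y\to(\langle x'=f(x)\&e>0\rangle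 x\neq y\leftrightarrow e>0)$ if $f(x)\ne0$; (Dadj) $\langle x'=f(x)\&Q(x)\rangle x=y\leftrightarrow\langle y'=-f(y)\&Q(y)\rangle y=x$; (RI) $[x'=f(x)]P\leftrightarrow\forall y[x'=f(x)\&P\vee x=y](x=y\to P\wedge\langle x'=f(x)\&P\vee x=y\rangle x\ne y)$; (BDG) $[x'=f(x),y'=g(x,y)\&Q(x)]\|y\|^2\le p(x)\to([x'=f(x)\&Q(x)]P(x)\leftrightarrow[x'=f(x),y'=g(x,y)\&Q(x)]P(x))$; (FI) $e_0=h(e_1)\leftrightarrow\phi_h(e_0,e_1)$ for each differentially-defined function symbol $h$ with defining formula $\phi_h$ as follows. (For this statement, provability only delimits which functions are in the language.) DIFFERENTIALLY-DEFINED FUNCTIONS. Each is a unary symbol $h$ given by $f\in\mathbb Q[x]^{n+1}$, $x=(x_0,\dots,x_n)$, $X\in\mathbb Q^{n+1}$, $T_0\in\mathbb Q$, with defining formula $\phi_h(x_0,t)\equiv\exists x_1\cdots x_n(\langle x'=-f(x),t'=-1\rangle(x=X\wedge t=T_0)\vee\langle x'=f(x),t'=1\rangle(x=X\wedge t=T_0))$, such that global existence, $\exists x_0\,\phi_h(x_0,t)$, is provable in dL. It is interpreted as $h:\mathbb R\to\mathbb R$, the $x_0$-coordinate of the global solution of $x'=f(x)$, $x(T_0)=X$. LANGUAGE. $\mathbb R_D$ is the ordered field $\mathbb R$ expanded by all these functions; $\mathcal L_D$ is its language (rational constants, $+,\cdot,\ge,>$, and these unary symbols). $\mathrm{FOL}_{\mathbb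 R}$ is the set of formulas without function symbols; functions definable in it may be used as abbreviations. Atomic formulas have the form $t\ge0$ or $t>0$. A bounded formula is $Q_1^{[a_1,b_1]}y_1\cdots Q_n^{[a_n,b_n]}y_n\,\psi$ with $Q_i\in\{\exists,\forall\}$, $\psi$ quantifier-free in conjunctive normal form (a positive combination of atomic formulas), $a_i,b_i$ terms without function symbols in the free variables and $y_1,\dots,y_{i-1}$, where $\exists^{[a,b]}y\,\chi:=\exists y(a\le y\wedge y\le b\wedge\chi)$, $\forall^{[a,b]}y\,\chi:=\forall y(a\le y\wedge y\le b\to\chi)$; the $[a_i,b_i]$ are genuine intervals, i.e. $a_i\le b_i$ for all real values of the free variables and all $y_j\in[a_j,b_j]$, $j<i$. $\mathrm{Fml}_B^{\succeq}(\mathcal L_D)$ is the set of bounded formulas in this normal form that are $\succeq$-pure, i.e. all of whose atomic formulas in $\psi$ are of the form $t\succeq0$ for the one fixed relation $\succeq$. $FV(\varphi)$ is the set of free variables. ENCLOSURES. $\mathbb{IQ}$ is the set of intervals $[\underline a,\overline a]$ with $\underline a\le\overline a$ in $\mathbb Q$. A domain of $\varphi$ is a map $D:FV(\varphi)\to\mathbb{IQ}$, identified with the box $\prod_xD_x$. $\mathrm{Term}(\varphi)$ is the set of terms (including subterms) occurring in $\varphi$, $\mathrm{Term}_F(\varphi)$ the subset of terms $f(e)$ with $f$ a function symbol. An enclosure of $\varphi$ is $I:\mathrm{Term}(\varphi)\to\mathbb{IQ}$, $e\mapsto I_e$, with: $I_x$ arbitrary for free variables $x$; $c\in I_c$ for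 rational constants $c$; $I_a\cup I_b\subseteq I_y$ for $y$ bound by $Q^{[a,b]}y$; $I_{t_1}+I_{t_2}\subseteq I_{t_1+t_2}$ and $I_{t_1}\cdot I_{t_2}\subseteq I_{t_1\cdot t_2}$ (interval arithmetic); $f(I_e)+[-1,1]\subseteq I_{f(e)}$. It extends $D$ if $I|_{FV(\varphi)}=D$. APPROXIMATIONS. An approximation $\mathcal F$ of $\varphi$ assigns to each $f(e)\in\mathrm{Term}_F(\varphi)$ an $\mathrm{FOL}_{\mathbb R}$ formula defining a function $\mathcal F_{f(e)}:\mathbb R\to\mathbb R$. $\|\mathcal F\|_I:=\max_{f(e)\in\mathrm{Term}_F(\varphi)}\sup_{s\in I_e}|\mathcal F_{f(e)}(s)-f(s)|$. For $0<\delta<\frac12$, $\mathcal F$ is $(I,\delta)$ admissible if $\|\mathcal F\|_I<\delta$. A sequence of $I$ admissible approximations $(\mathcal F_\delta)_\delta$ is indexed by a sequence of rationals $\delta=\delta_i\in(0,\frac12)$ with $\delta_i\to0$, each $\mathcal F_{\delta_i}$ being $(I,\delta_i)$ admissible. PERTURBATIONS. $\mathcal A^\forall_{\mathcal F}(\varphi,\delta)$ is defined inductively: it is $\varphi$ if $\varphi$ is atomic without function symbols; for atomic $t(f(e),\vec x)\succeq0$ ($e$ without function symbols) it is $\forall^{[\mathcal F_{f(e)}(e)-\delta,\mathcal F_{f(e)}(e)+\delta]}w\ \mathcal A^\forall_{\mathcal F_{w\mapsto f(e)}}(t(w,\vec x)\succeq0,\delta)$, where $w$ is fresh and replaces $f(e)$,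 and $\mathcal F_{w\mapsto f(e)}(\theta(w,\vec x)):=\mathcal F(\theta(f(e),\vec x))$; it commutes with $\wedge,\vee$ and bounded quantifiers. $\mathcal A^\exists_{\mathcal F}(\varphi,\delta)$ is defined identically with $\exists w$ in place of $\forall w$. ROBUSTNESS. $[\![\varphi]\!]_D:=D\cap[\![\varphi]\!]$ is the set of points of $D$ satisfying $\varphi$ (for sentences, the truth value). $\varphi$ is $\forall$-robust relative to $D$ if there exist an enclosure $I$ extending $D$ and a sequence of $I$ admissible approximations $(\mathcal F_\delta)_\delta$ with $[\![\varphi]\!]_D=\bigcup_\delta[\![\mathcal A^\forall_{\mathcal F_\delta}(\varphi,\delta)]\!]_D$; it is $\exists$-robust relative to $D$ if there exist such $I$ and $(\mathcal F_\delta)_\delta$ with $[\![\varphi]\!]_D=\bigcap_\delta[\![\mathcal A^\exists_{\mathcal F_\delta}(\varphi,\delta)]\!]_D$ (for sentences, union/intersection mean disjunction/conjunction of truth values).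
   Formalization: In the calculus delimiting the function symbols, axiom RI is used only under the proviso f(x)≠0 (as printed for Cont), since without it x'=0 makes the calculus inconsistent; bound variables are taken pairwise distinct and distinct from the free ones. *)

(* Defs.v *)
From HB Require Import structures.
From mathcomp Require Import all_boot all_order all_algebra perm.
From mathcomp Require Import all_classical all_reals all_analysis.
From mathcomp Require mpoly.

Set Implicit Arguments.
Unset Strict Implicit.
Unset Printing Implicit Defensive.

Import Order.TTheory GRing.Theory Num.Theory.
Import numFieldNormedType.Exports.
Local Open Scope classical_set_scope.
Local Open Scope ring_scope.

(* The data (f, X, T0) of a polynomial initial value problem x' = f(x),
   x(T0) = X.  Every such datum may be used as a unary function symbol; which
   of them belong to the language is decided by [diff_defined] below. *)
Record ivp := Ivp {
  ivp_dim : nat;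
  ivp_rhs : 'I_ivp_dim.+1 -> mpoly.mpoly ivp_dim.+1 rat;
  ivp_init : 'I_ivp_dim.+1 -> rat;
  ivp_time : rat }.

Arguments ivp_rhs : clear implicits.
Arguments ivp_init : clear implicits.

HB.instance Definition _ := gen_eqMixin ivp.

Notation var := nat (only parsing).

Inductive term :=
| TVar of var
| TCst of rat
| TAdd of term & term
| TMul of term & term
| TApp of ivp & term.

HB.instance Definition _ := gen_eqMixin term.

Inductive cmp := Eq | Ne | Ge | Gt | Le | Lt.

(* [:: (x1, f1); ...; (xk, fk)] stands for x1' = f1, ..., xk' = fk *)
Definition ode := seq (var * term).

Inductive fml :=
| FCmp of cmp & term & term
| FAnd of fml & fml
| FOr of fml & fml
| FNot of fml
| FImp of fml & fml
| FAll of var & fml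
| FEx of var & fml
| FBox of ode & fml & fml   (* FBox o Q P is [o & Q] P *)
| FDia of ode & fml & fml.  (* FDia o Q P is <o & Q> P *)

HB.instance Definition _ := gen_eqMixin fml.

Definition FTrue := FCmp Eq (TCst 0) (TCst 0).
Definition FIff P Q := FAnd (FImp P Q) (FImp Q P).
Definition FConj (s : seq fml) := foldr FAnd FTrue s.
Definition FAlls (xs : seq var) P := foldr FAll P xs.
Definition FExs (xs : seq var) P := foldr FEx P xs.
Definition TNeg t := TMul (TCst (-1)) t.
Definition TSum (s : seq term) := foldr TAdd (TCst 0) s.

(* polynomial p with the terms [a i] in place of its indeterminates *)
Definition term_of_mpoly n (p : mpoly.mpoly n rat) (a : 'I_n -> term) : term :=
  TSum [seq TMul (TCst (mpoly.mcoeff m p))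
           (foldr (fun i t => iter (mpoly.fun_of_multinom m i) (TMul (a i)) t)
                  (TCst 1) (enum 'I_n))
       | m <- mpoly.msupp p].

Fixpoint tvars t : seq var :=
  match t with
  | TVar x => [:: x]
  | TCst _ => [::]
  | TAdd t1 t2 | TMul t1 t2 => tvars t1 ++ tvars t2
  | TApp _ e => tvars e
  end.

Fixpoint tsyms t : seq ivp :=
  match t with
  | TVar _ | TCst _ => [::]
  | TAdd t1 t2 | TMul t1 t2 => tsyms t1 ++ tsyms t2
  | TApp h e => h :: tsyms e
  end.

Definition function_free t : bool := nilp (tsyms t).

Definition bound_vars (o : ode) : seq var := unzip1 o.

Definition ode_vars (o : ode) : seq var :=
  bound_vars o ++ flatten [seq tvars p.2 | p <- o].

Fixpoint fv P : seq var :=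
  match P with
  | FCmp _ t u => tvars t ++ tvars u
  | FAnd P Q | FOr P Q | FImp P Q => fv P ++ fv Q
  | FNot P => fv P
  | FAll x P | FEx x P => [seq z <- fv P | z != x]
  | FBox o Q P | FDia o Q P => ode_vars o ++ fv Q ++ fv P
  end.

Fixpoint syms P : seq ivp :=
  match P with
  | FCmp _ t u => tsyms t ++ tsyms u
  | FAnd P Q | FOr P Q | FImp P Q => syms P ++ syms Q
  | FNot P | FAll _ P | FEx _ P => syms P
  | FBox o Q P | FDia o Q P =>
      flatten [seq tsyms p.2 | p <- o] ++ syms Q ++ syms P
  end.

(* FOL_R: no function symbols and no modalities *)
Fixpoint fol P : bool :=
  match P with
  | FCmp _ t u => function_free t && function_free u
  | FAnd P Q | FOr P Q | FImp P Q => fol P && fol Q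
  | FNot P | FAll _ P | FEx _ P => fol P
  | FBox _ _ _ | FDia _ _ _ => false
  end.

Fixpoint wf_modalities P : bool :=
  match P with
  | FCmp _ _ _ => true
  | FAnd P Q | FOr P Q | FImp P Q => wf_modalities P && wf_modalities Q
  | FNot P | FAll _ P | FEx _ P => wf_modalities P
  | FBox o Q P | FDia o Q P =>
      [&& uniq (bound_vars o), fol Q & wf_modalities P]
  end.

(* well-formed formulas over the function symbols D *)
Definition wf (D : ivp -> Prop) P : Prop :=
  wf_modalities P /\ forall h, h \in syms P -> D h.

Definition fresh (s : seq var) : var := (\max_(x <- s) x).+1%N.

Definition upd (T : Type) (s : var -> T) (x : var) (v : T) : var -> T :=
  fun z => if z == x then v else s z.

Definition subst1 (x : var) (t : term) : var -> term := upd TVar x t.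

Definition substs (xs : seq var) (ts : seq term) : var -> term :=
  fun z => if z \in xs then nth (TVar z) ts (index z xs) else TVar z.

Fixpoint tsubst (s : var -> term) t : term :=
  match t with
  | TVar x => s x
  | TCst c => TCst c
  | TAdd t1 t2 => TAdd (tsubst s t1) (tsubst s t2)
  | TMul t1 t2 => TMul (tsubst s t1) (tsubst s t2)
  | TApp h e => TApp h (tsubst s e)
  end.

Fixpoint subst (s : var -> term) P : fml :=
  match P with
  | FCmp c t u => FCmp c (tsubst s t) (tsubst s u)
  | FAnd P Q => FAnd (subst s P) (subst s Q)
  | FOr P Q => FOr (subst s P) (subst s Q)
  | FNot P => FNot (subst s P)
  | FImp P Q => FImp (subst s P) (subst s Q)
  | FAll x P => FAll x (subst (upd s x (TVar x)) P)
  | FEx x P => FEx x (subst (upd s x (TVar x)) P)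
  | FBox o Q P =>
      FBox [seq (p.1, tsubst s p.2) | p <- o] (subst s Q) (subst s P)
  | FDia o Q P =>
      FDia [seq (p.1, tsubst s p.2) | p <- o] (subst s Q) (subst s P)
  end.

(* [subst s P] is capture-free and replaces no variable bound by an ODE *)
Fixpoint admissible (s : var -> term) P : bool :=
  match P with
  | FCmp _ _ _ => true
  | FAnd P Q | FOr P Q | FImp P Q => admissible s P && admissible s Q
  | FNot P => admissible s P
  | FAll x P | FEx x P =>
      all (fun z => (z == x) || (x \notin tvars (s z))) (fv P) &&
      admissible (upd s x (TVar x)) P
  | FBox o Q P | FDia o Q P =>
      [&& all (fun z => if z \in bound_vars o then s z == TVar z
                        else ~~ has (mem (tvars (s z))) (bound_vars o))
              (ode_vars o ++ fv Q ++ fv P),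
          admissible s Q & admissible s P]
  end.

Definition swap (x y z : var) : var :=
  if z == x then y else if z == y then x else z.

(* exchanges x and y everywhere, at bound occurrences as well *)
Fixpoint rename (x y : var) P : fml :=
  let ts := tsubst (fun z => TVar (swap x y z)) in
  let os := map (fun p : var * term => (swap x y p.1, ts p.2)) in
  match P with
  | FCmp c t u => FCmp c (ts t) (ts u)
  | FAnd P Q => FAnd (rename x y P) (rename x y Q)
  | FOr P Q => FOr (rename x y P) (rename x y Q)
  | FNot P => FNot (rename x y P)
  | FImp P Q => FImp (rename x y P) (rename x y Q)
  | FAll z P => FAll (swap x y z) (rename x y P)
  | FEx z P => FEx (swap x y z) (rename x y P)
  | FBox o Q P => FBox (os o) (rename x y Q) (rename x y P)
  | FDia o Q P => FDia (os o) (rename x y Q) (rename x y P)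
  end.

Definition state (R : realType) := var -> R.

Definition global_solution (R : realType) (h : ivp)
    (Y : R -> 'I_(ivp_dim h).+1 -> R) : Prop :=
  (forall i, Y (ratr (ivp_time h)) i = ratr (ivp_init h i)) /\
  (forall (t : R) i, is_derive t 1 (fun s : R => Y s i)
                 (mpoly.mmap ratr (Y t) (ivp_rhs h i))).

(* The x_0-coordinate of the global solution, which exists for every symbol
   of the language; the zero function is a dummy value for the other data. *)
Definition interp (R : realType) (h : ivp) : R -> R :=
  xget (fun=> 0) [set g | exists2 Y, @global_solution R h Y & forall t, g t = Y t ord0].

Fixpoint tval (R : realType) (w : state R) t : R :=
  match t with
  | TVar x => w x
  | TCst c => ratr c
  | TAdd t1 t2 => tval w t1 + tval w t2
  | TMul t1 t2 => tval w t1 * tval w t2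
  | TApp h e => interp h (tval w e)
  end.

Definition cmp_sem (R : realType) (c : cmp) (a b : R) : Prop :=
  match c with
  | Eq => a = b | Ne => a <> b
  | Ge => b <= a | Gt => b < a
  | Le => a <= b | Lt => a < b
  end.

(* Phi restricted to [0, T[ solves the ODE from w; the variables it does not
   bind keep their values.  Values of Phi outside [0, T[ are irrelevant. *)
Definition solution (R : realType) (o : ode) (w : state R) (T : \bar R)
    (Phi : R -> state R) : Prop :=
  [/\ Phi 0 = w,
      forall s z, 0 <= s -> (s%:E < T)%E -> z \notin bound_vars o ->
        Phi s z = w z &
      forall p, p \in o ->
        {within [set s : R | 0 <= s /\ (s%:E < T)%E],
           continuous (fun s => Phi s p.1)} /\
        (forall s : R, 0 < s -> (s%:E < T)%E ->
           is_derive s 1 (fun r : R => Phi r p.1) (tval (Phi s) p.2))].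

Definition right_maximal_solution (R : realType) (o : ode) (w : state R)
    (T : \bar R) (Phi : R -> state R) : Prop :=
  [/\ (0 < T)%E, solution o w T Phi &
      forall T' Psi, solution o w T' Psi -> (T' <= T)%E].

Fixpoint sat (R : realType) (w : state R) P : Prop :=
  match P with
  | FCmp c t u => cmp_sem c (tval w t) (tval w u)
  | FAnd P Q => sat w P /\ sat w Q
  | FOr P Q => sat w P \/ sat w Q
  | FNot P => ~ sat w P
  | FImp P Q => sat w P -> sat w Q
  | FAll x P => forall v : R, sat (upd w x v) P
  | FEx x P => exists v : R, sat (upd w x v) P
  | FBox o Q P =>
      forall T Phi, right_maximal_solution o w T Phi ->
      forall tau : R, 0 <= tau -> (tau%:E < T)%E ->
      (forall xi, 0 <= xi <= tau -> sat (Phi xi) Q) -> sat (Phi tau) P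
  | FDia o Q P =>
      exists T Phi, right_maximal_solution o w T Phi /\
      exists tau : R, [/\ 0 <= tau, (tau%:E < T)%E,
        forall xi, 0 <= xi <= tau -> sat (Phi xi) Q & sat (Phi tau) P]
  end.

(* phi_h(x_0, t), with k, ..., k + n for x_0, ..., x_n and k + n + 1 for t *)
Definition phi (h : ivp) (k : var) : fml :=
  let n := ivp_dim h in
  let x (i : 'I_n.+1) := (k + i)%N in
  let t := (k + n.+1)%N in
  let f i := term_of_mpoly (ivp_rhs h i) (fun j => TVar (x j)) in
  let goal := FAnd (FConj [seq FCmp Eq (TVar (x i)) (TCst (ivp_init h i))
                          | i <- enum 'I_n.+1])
                   (FCmp Eq (TVar t) (TCst (ivp_time h))) in
  let bwd := rcons [seq (x i, TNeg (f i)) | i <- enum 'I_n.+1] (t, TCst (-1)) in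
  let fwd := rcons [seq (x i, f i) | i <- enum 'I_n.+1] (t, TCst 1) in
  FExs (iota k.+1 n) (FOr (FDia bwd FTrue goal) (FDia fwd FTrue goal)).

(* phi_h(e0, e1): x_0 and t are bound by the ODE, so the arguments are passed
   by equations, with k chosen beyond the variables of e0 and e1. *)
Definition phi_inst (h : ivp) (e0 e1 : term) : fml :=
  let k := fresh (tvars e0 ++ tvars e1) in
  let t := (k + (ivp_dim h).+1)%N in
  FEx k (FEx t (FAnd (FAnd (FCmp Eq (TVar k) e0) (FCmp Eq (TVar t) e1))
                     (phi h k))).

Definition global_existence (h : ivp) : fml := FEx 0%N (phi h 0).

(* the initial value problem of h with the coordinates 0 and i exchanged: it
   defines the i-th coordinate of the solution *)
Definition coord_ivp (h : ivp) (i : 'I_(ivp_dim h).+1) : ivp :=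
  let s := tperm ord0 i in
  Ivp (fun k => mpoly.msym s (ivp_rhs h (s k))) (fun k => ivp_init h (s k))
      (ivp_time h).

Fixpoint lie (o : ode) t : term :=
  match t with
  | TVar x => nth (TCst 0) (unzip2 o) (index x (bound_vars o))
  | TCst _ => TCst 0
  | TAdd t1 t2 => TAdd (lie o t1) (lie o t2)
  | TMul t1 t2 => TAdd (TMul (lie o t1) t2) (TMul t1 (lie o t2))
  | TApp h e =>
      TMul (term_of_mpoly (ivp_rhs h ord0) (fun i => TApp (coord_ivp i) e))
           (lie o e)
  end.

Definition disjoint_vars (s1 s2 : seq var) : bool := ~~ has (mem s1) s2.

Definition vec_eq (xs : seq var) (ts : seq term) : fml :=
  FConj [seq FCmp Eq (TVar p.1) p.2 | p <- zip xs ts].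

Definition vec_zero (ts : seq term) : fml :=
  FConj [seq FCmp Eq t (TCst 0) | t <- ts].

Definition is_term_solution (R : realType) (o : ode) (ys : seq term) (t : var) :=
  forall w : state R,
    solution o w +oo%E
      (fun s z => if z \in bound_vars o
                  then tval (upd w t s) (substs (bound_vars o) ys z) else w z).

Inductive axiom (R : realType) (D : ivp -> Prop) : fml -> Prop :=
| ax_dia o Q P :
    axiom R D (FIff (FDia o Q P) (FNot (FBox o Q (FNot P))))
| ax_solve o ys t P :
    size ys = size o -> t \notin ode_vars o ++ fv P ->
    (forall y h, y \in ys -> h \in tsyms y -> D h) ->
    is_term_solution R o ys t ->
    admissible (substs (bound_vars o) ys) P ->
    axiom R D (FIff (FDia o FTrue P)
      (FEx t (FAnd (FCmp Ge (TVar t) (TCst 0))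
                   (subst (substs (bound_vars o) ys) P))))
| ax_barcan o Q y P :
    y \notin ode_vars o ++ fv Q ->
    axiom R D (FIff (FDia o Q (FEx y P)) (FEx y (FDia o Q P)))
| ax_K o Q P S :
    axiom R D (FImp (FBox o Q (FImp P S)) (FImp (FBox o Q P) (FBox o Q S)))
| ax_V o Q P :
    disjoint_vars (bound_vars o) (fv P) ->
    axiom R D (FImp P (FBox o Q P))
| ax_DG o Q P y a b :
    y \notin ode_vars o ++ tvars a ++ tvars b ++ fv Q ++ fv P ->
    axiom R D (FIff (FBox o Q P)
      (FEx y (FBox (rcons o (y, TAdd (TMul a (TVar y)) b)) Q P)))
| ax_DGi o Q P y g :
    y \notin ode_vars o ++ fv Q ++ fv P ->
    axiom R D (FImp (FBox o Q P) (FAll y (FBox (rcons o (y, g)) Q P)))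
| ax_DX o Q P :
    axiom R D (FIff (FBox o Q P) (FImp Q (FAnd P (FBox o Q P))))
| ax_Uniq o Q1 Q2 P :
    axiom R D (FIff (FDia o (FAnd Q1 Q2) P) (FAnd (FDia o Q1 P) (FDia o Q2 P)))
| ax_Cont o ys e :
    size ys = size o -> uniq ys -> disjoint_vars ys (ode_vars o ++ tvars e) ->
    let x_eq_y := vec_eq (bound_vars o) (map TVar ys) in
    let e_pos := FCmp Gt e (TCst 0) in
    axiom R D (FImp (FNot (vec_zero (unzip2 o)))
      (FImp x_eq_y (FIff (FDia o e_pos (FNot x_eq_y)) e_pos)))
| ax_Dadj o Q ys :
    size ys = size o -> uniq ys -> disjoint_vars ys (ode_vars o ++ fv Q) ->
    let xs := bound_vars o in
    let s := substs xs (map TVar ys) in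
    admissible s Q ->
    axiom R D (FIff (FDia o Q (vec_eq xs (map TVar ys)))
      (FDia (zip ys [seq TNeg (tsubst s f) | f <- unzip2 o]) (subst s Q)
            (vec_eq ys (map TVar xs))))
(* Like Cont, real induction needs f(x) <> 0: at an equilibrium
   <x' = f(x) & _> x <> y is false when x = y. *)
| ax_RI o P ys :
    size ys = size o -> uniq ys -> disjoint_vars ys (ode_vars o ++ fv P) ->
    let x_eq_y := vec_eq (bound_vars o) (map TVar ys) in
    let Q := FOr P x_eq_y in
    axiom R D (FImp (FNot (vec_zero (unzip2 o)))
      (FIff (FBox o FTrue P)
        (FAlls ys (FBox o Q
          (FImp x_eq_y (FAnd P (FDia o Q (FNot x_eq_y))))))))
| ax_BDG o o' Q P p :
    disjoint_vars (bound_vars o') (ode_vars o ++ fv Q ++ fv P ++ tvars p) ->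
    axiom R D (FImp
      (FBox (o ++ o') Q
        (FCmp Le (TSum [seq TMul (TVar y) (TVar y) | y <- bound_vars o']) p))
      (FIff (FBox o Q P) (FBox (o ++ o') Q P)))
| ax_FI h e0 e1 :
    D h -> axiom R D (FIff (FCmp Eq e0 (TApp h e1)) (phi_inst h e0 e1))
(* equality: replacement of equals, and bound renaming *)
| ax_eq_subst x s t P :
    admissible (subst1 x s) P -> admissible (subst1 x t) P ->
    axiom R D (FImp (FCmp Eq s t)
      (FImp (subst (subst1 x s) P) (subst (subst1 x t) P)))
| ax_eq_rename x y P :
    axiom R D (FImp (FCmp Eq (TVar x) (TVar y)) (FIff P (rename x y P)))
(* the order of the equations of a system is immaterial *)
| ax_perm o o' Q P :
    perm_eq o o' -> axiom R D (FIff (FBox o Q P) (FBox o' Q P)).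

(* Sequents "Gamma |- Delta" of dL over the function symbols D.  A symbol
   outside D is constrained by no rule except those of first-order logic, where
   it is an arbitrary function. *)
Inductive dL (R : realType) (D : ivp -> Prop) : seq fml -> seq fml -> Prop :=
| dL_id P G H : P \in G -> P \in H -> dL R D G H
| dL_weaken G G' H H' :
    {subset G <= G'} -> {subset H <= H'} -> dL R D G H -> dL R D G' H'
| dL_cut P G H : dL R D G (P :: H) -> dL R D (P :: G) H -> dL R D G H
| dL_notL P G H : dL R D G (P :: H) -> dL R D (FNot P :: G) H
| dL_notR P G H : dL R D (P :: G) H -> dL R D G (FNot P :: H)
| dL_andL P Q G H : dL R D [:: P, Q & G] H -> dL R D (FAnd P Q :: G) H
| dL_andR P Q G H :
    dL R D G (P :: H) -> dL R D G (Q :: H) -> dL R D G (FAnd P Q :: H)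
| dL_orL P Q G H :
    dL R D (P :: G) H -> dL R D (Q :: G) H -> dL R D (FOr P Q :: G) H
| dL_orR P Q G H : dL R D G [:: P, Q & H] -> dL R D G (FOr P Q :: H)
| dL_impL P Q G H :
    dL R D G (P :: H) -> dL R D (Q :: G) H -> dL R D (FImp P Q :: G) H
| dL_impR P Q G H : dL R D (P :: G) (Q :: H) -> dL R D G (FImp P Q :: H)
| dL_allL x t P G H :
    admissible (subst1 x t) P ->
    dL R D (subst (subst1 x t) P :: G) H -> dL R D (FAll x P :: G) H
| dL_allR x P G H :
    x \notin flatten (map fv (G ++ H)) ->
    dL R D G (P :: H) -> dL R D G (FAll x P :: H)
| dL_exL x P G H :
    x \notin flatten (map fv (G ++ H)) ->
    dL R D (P :: G) H -> dL R D (FEx x P :: G) H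
| dL_exR x t P G H :
    admissible (subst1 x t) P ->
    dL R D G (subst (subst1 x t) P :: H) -> dL R D G (FEx x P :: H)
| dL_real G H :
    all fol (G ++ H) ->
    (forall w : state R, (forall P, P \in G -> sat w P) ->
       exists2 P, P \in H & sat w P) ->
    dL R D G H
| dL_axiom P : axiom R D P -> wf D P -> dL R D [::] [:: P]
| dL_G o Q P G :
    wf D (FBox o Q P) -> dL R D [::] [:: P] -> dL R D G [:: FBox o Q P]
| dL_dW o Q P G :
    wf D (FBox o Q P) -> dL R D [:: Q] [:: P] -> dL R D G [:: FBox o Q P]
| dL_dI c o Q p q G :
    c = Ge \/ c = Gt -> wf D (FBox o Q (FCmp c p q)) ->
    dL R D (Q :: G) [:: FCmp c p q] ->
    dL R D [:: Q] [:: FCmp Ge (lie o p) (lie o q)] ->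
    dL R D G [:: FBox o Q (FCmp c p q)]
| dL_dC o Q C P G :
    wf D (FBox o (FAnd Q C) P) ->
    dL R D G [:: FBox o Q C] -> dL R D G [:: FBox o (FAnd Q C) P] ->
    dL R D G [:: FBox o Q P].

(* The least fixed point reflects that a proof of global existence may use FI
   for the symbols already known to be differentially-defined. *)
Inductive diff_defined (R : realType) : ivp -> Prop :=
| DiffDefined (D : ivp -> Prop) h :
    (forall g, D g -> diff_defined R g) ->
    dL R D [::] [:: global_existence h] ->
    diff_defined R h.

Inductive quant := QAll | QEx.

(* BAtom r t is the atomic formula "t r 0"; BQ q y a b P is q^[a,b] y P. *)
Inductive bfml :=
| BAtom of cmp & term
| BAnd of bfml & bfml
| BOr of bfml & bfml
| BQ of quant & var & term & term & bfml.

Definition bounded_quant (q : quant) (y : var) (dom P : fml) : fml :=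
  match q with
  | QAll => FAll y (FImp dom P)
  | QEx => FEx y (FAnd dom P)
  end.

Definition in_bounds (y : var) (a b : term) : fml :=
  FAnd (FCmp Le a (TVar y)) (FCmp Le (TVar y) b).

Fixpoint fml_of (P : bfml) : fml :=
  match P with
  | BAtom r t => FCmp r t (TCst 0)
  | BAnd P Q => FAnd (fml_of P) (fml_of Q)
  | BOr P Q => FOr (fml_of P) (fml_of Q)
  | BQ q y a b P => bounded_quant q y (in_bounds y a b) (fml_of P)
  end.

Coercion fml_of : bfml >-> fml.

Inductive clause (r : cmp) : bfml -> Prop :=
| clause_atom t : clause r (BAtom r t)
| clause_or P Q : clause r P -> clause r Q -> clause r (BOr P Q).

Inductive cnf (r : cmp) : bfml -> Prop :=
| cnf_clause P : clause r P -> cnf r P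
| cnf_and P Q : cnf r P -> cnf r Q -> cnf r (BAnd P Q).

(* Pre holds of the states in which the enclosing bounded variables lie in
   their intervals; it is only used to say that [a, b] is a genuine interval. *)
Inductive normal_form (R : realType) (r : cmp) :
    (state R -> Prop) -> bfml -> Prop :=
| nf_cnf Pre P : cnf r P -> normal_form r Pre P
| nf_quant (Pre : state R -> Prop) q y a b P :
    function_free a -> function_free b ->
    y \notin tvars a ++ tvars b ->
    (forall w, Pre w -> tval w a <= tval w b) ->
    normal_form r (fun w => Pre w /\ tval w a <= w y <= tval w b) P ->
    normal_form r Pre (BQ q y a b P).

Fixpoint ranges (P : bfml) : seq (var * (term * term)) :=
  match P with
  | BAtom _ _ => [::]
  | BAnd P Q | BOr P Q => ranges P ++ ranges Q
  | BQ _ y a b P => (y, (a, b)) :: ranges P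
  end.

(* Fml_B^r(L_D), with bound variables distinct from each other and from the
   free variables *)
Definition bounded_pure (R : realType) (r : cmp) (P : bfml) : Prop :=
  [/\ normal_form r (fun _ : state R => True) P,
      uniq (unzip1 (ranges P)),
      disjoint_vars (unzip1 (ranges P)) (fv P) &
      forall h, h \in syms P -> diff_defined R h].

Fixpoint subterms t : seq term :=
  t :: match t with
       | TVar _ | TCst _ => [::]
       | TAdd t1 t2 | TMul t1 t2 => subterms t1 ++ subterms t2
       | TApp _ e => subterms e
       end.

Fixpoint terms (P : bfml) : seq term :=
  match P with
  | BAtom _ t => TCst 0 :: subterms t
  | BAnd P Q | BOr P Q => terms P ++ terms Q
  | BQ _ y a b P => TVar y :: subterms a ++ subterms b ++ terms P
  end.

(* the f(e) in Term_F(P), as pairs (f, e) *)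
Definition apps (P : bfml) : seq (ivp * term) :=
  pmap (fun t => if t is TApp f e then Some (f, e) else None) (terms P).

Record IQ := MkIQ { lo : rat; hi : rat; lo_le_hi : lo <= hi }.

Definition itv (R : realType) (i : IQ) : set R :=
  [set x | ratr (lo i) <= x <= ratr (hi i)].
Arguments itv : clear implicits.

(* Only the values of a domain of P on the free variables of P, and those of
   an enclosure of P on the terms of P, matter. *)
Definition domain := var -> IQ.
Definition enclosure_map := term -> IQ.

Definition enclosure (R : realType) (P : bfml) (I : enclosure_map) : Prop :=
  [/\ forall c, TCst c \in terms P -> itv R (I (TCst c)) (ratr c),
      forall y a b, (y, (a, b)) \in ranges P ->
        itv R (I a) `|` itv R (I b) `<=` itv R (I (TVar y)),
      forall t1 t2, TAdd t1 t2 \in terms P ->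
        [set x + y | x in itv R (I t1) & y in itv R (I t2)]
          `<=` itv R (I (TAdd t1 t2)),
      forall t1 t2, TMul t1 t2 \in terms P ->
        [set x * y | x in itv R (I t1) & y in itv R (I t2)]
          `<=` itv R (I (TMul t1 t2)) &
      forall f e, TApp f e \in terms P ->
        [set x + z | x in interp f @` itv R (I e)
                   & z in [set z : R | -1 <= z <= 1]]
          `<=` itv R (I (TApp f e))].

Definition extends (P : bfml) (I : enclosure_map) (D : domain) : Prop :=
  forall x, x \in fv P -> I (TVar x) = D x.

(* A defining formula has free variables 0 (argument) and 1 (value). *)
Definition graph (R : realType) (A : fml) (s v : R) : Prop :=
  sat (upd (upd (fun=> 0) 0%N s) 1%N v) A.

Definition defines_function (R : realType) (A : fml) : Prop :=
  [/\ fol A, {subset fv A <= [:: 0%N; 1%N]} &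
      forall s : R, exists! v : R, graph A s v].

Definition fun_of (R : realType) (A : fml) (s : R) : R :=
  xget 0 [set v | graph A s v].

(* assigns a defining formula to each term f(e) *)
Definition approximation := term -> fml.

Definition is_approximation (R : realType) (P : bfml) (F : approximation) :=
  forall f e, (f, e) \in apps P -> defines_function R (F (TApp f e)).

Definition approx_norm (R : realType) (P : bfml) (I : enclosure_map)
    (F : approximation) : \bar R :=
  \big[maxe/0%E]_(p <- apps P)
    ereal_sup [set (`| fun_of (F (TApp p.1 p.2)) s - interp p.1 s |)%:E
              | s in itv R (I p.2)].

Definition admissible_approx (R : realType) (P : bfml) (I : enclosure_map)
    (delta : rat) (F : approximation) : Prop :=
  [/\ 0 < delta < 1 / 2, is_approximation R P F &
      (approx_norm R P I F < (ratr delta : R)%:E)%E].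

Definition admissible_sequence (R : realType) (P : bfml) (I : enclosure_map)
    (delta : nat -> rat) (F : rat -> approximation) : Prop :=
  (forall i, admissible_approx R P I (delta i) (F (delta i))) /\
  ((fun i => ratr (delta i) : R) @ \oo --> (0 : R)).

(* "F(e) - d <= w <= F(e) + d" with the abbreviation F(e) for the function
   defined by A spelled out: u is e and v is its value.  The variables 0 and 1
   of A are bound here, so u and v are chosen different from them. *)
Definition near_value (A : fml) (e : term) (d : rat) (w : var) : fml :=
  let u := fresh [:: 0%N, 1%N, w & tvars e] in
  let v := u.+1 in
  let A_uv := FEx 0%N (FEx 1%N
    (FAnd (FAnd (FCmp Eq (TVar 0) (TVar u)) (FCmp Eq (TVar 1) (TVar v))) A)) in
  FEx u (FEx v (FAnd (FAnd (FCmp Eq (TVar u) e) A_uv)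
    (in_bounds w (TAdd (TVar v) (TCst (- d))) (TAdd (TVar v) (TCst d))))).

(* the leftmost f(e) in t with e function-free *)
Fixpoint innermost t : option (ivp * term) :=
  match t with
  | TVar _ | TCst _ => None
  | TAdd t1 t2 | TMul t1 t2 =>
      if innermost t1 is Some p then Some p else innermost t2
  | TApp f e => if innermost e is Some p then Some p else Some (f, e)
  end.

Fixpoint abstract_term (s : term) (w : var) t : term :=
  if t == s then TVar w else
  match t with
  | TVar _ | TCst _ => t
  | TAdd t1 t2 => TAdd (abstract_term s w t1) (abstract_term s w t2)
  | TMul t1 t2 => TMul (abstract_term s w t1) (abstract_term s w t2)
  | TApp f e => TApp f (abstract_term s w e)
  end.

(* k bounds the number of function applications in t *)
Fixpoint perturb_atom (q : quant) (d : rat) (r : cmp) (k : nat)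
    (F : approximation) (t : term) : fml :=
  match k, innermost t with
  | k'.+1, Some (f, e) =>
      let w := fresh (tvars t) in
      let Fw := fun theta => F (tsubst (subst1 w (TApp f e)) theta) in
      bounded_quant q w (near_value (F (TApp f e)) e d w)
        (perturb_atom q d r k' Fw (abstract_term (TApp f e) w t))
  | _, _ => FCmp r t (TCst 0)
  end.

(* A^forall_F(P, d) for q = QAll and A^exists_F(P, d) for q = QEx *)
Fixpoint perturb (q : quant) (F : approximation) (d : rat) (P : bfml) : fml :=
  match P with
  | BAtom r t => perturb_atom q d r (size (tsyms t)) F t
  | BAnd P Q => FAnd (perturb q F d P) (perturb q F d Q)
  | BOr P Q => FOr (perturb q F d P) (perturb q F d Q)
  | BQ q' y a b P => bounded_quant q' y (in_bounds y a b) (perturb q F d P)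
  end.

(* Points of the box given by D on the variables xs, as states, that satisfy A *)
Definition truth_set (R : realType) (xs : seq var) (D : domain) (A : fml) :
    set (state R) :=
  [set w | (forall x, x \in xs -> itv R (D x) (w x)) /\ sat w A].

Definition forall_robust (R : realType) (P : bfml) (D : domain) : Prop :=
  exists I delta F,
    [/\ enclosure R P I, extends P I D, admissible_sequence R P I delta F &
        truth_set (R := R) (fv P) D P =
        \bigcup_i truth_set (fv P) D (perturb QAll (F (delta i)) (delta i) P)].

Definition exists_robust (R : realType) (P : bfml) (D : domain) : Prop :=
  exists I delta F,
    [/\ enclosure R P I, extends P I D, admissible_sequence R P I delta F &
        truth_set (R := R) (fv P) D P =
        \bigcap_i truth_set (fv P) D (perturb QEx (F (delta i)) (delta i) P)].

(* Main.v *)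
Require Import Defs.
From mathcomp Require Import all_boot all_order all_algebra.
From mathcomp Require Import all_classical all_reals all_analysis.
From mathcomp Require Import ring lra.

Set Implicit Arguments.
Unset Strict Implicit.
Unset Printing Implicit Defensive.

Import Order.TTheory GRing.Theory Num.Theory.
Import numFieldNormedType.Exports.
Local Open Scope classical_set_scope.
Local Open Scope ring_scope.

(* [tval] of tuple.v would otherwise shadow the value of a term. *)
Local Notation tval := Defs.tval.

(* Every function symbol denotes a continuous function, so on a box the terms of
   varphi are uniformly continuous, and perturbing the innermost function values
   by at most 2 delta moves the value of every atom by at most some e, uniformly
   on the box, with e -> 0 as delta -> 0.  The exact value is always among the
   perturbed ones.  It remains to see that the truth of varphi is stable in e:
   if varphi holds with its atoms relaxed to t >= - e for all e > 0, then it
   holds with t >= 0.  For the bounded existential quantifiers this is sequential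
   compactness: a cluster point of witnesses for e -> 0 is a witness, because the
   relaxed satisfaction is itself uniformly continuous in the state up to a
   further relaxation (this uses that the quantifier intervals are genuine, so
   that witnesses can be clamped into nearby intervals).  The case of > follows
   by applying this to the dual formula.  Admissible approximations are rational
   step functions. *)

(** * Compactness and uniform continuity on the real line *)

Lemma segment_cluster (R : realType) (a b : R) (u : nat -> R) :
  (forall n, a <= u n <= b) ->
  exists2 c : R, a <= c <= b &
    forall e : R, 0 < e -> forall N, exists2 n, (N <= n)%N & `|u n - c| < e.
Proof.
move=> uab.
have Fab : (u @ \oo) `[a, b]%classic by exists 0%N => // n _; rewrite /= in_itv; exact: uab.
have [c [cab cu]] := segment_compact (fmap_proper_filter u _) Fab.
exists c; first by move: cab; rewrite /= in_itv.
move=> e e0 N.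
have [||x [[n /= Nn <-] xc]] := cu (u @` [set n | (N <= n)%N]) (ball c e).
- by exists N => // n /= Nn; exists n.
- exact: nbhsx_ballx.
- by exists n => //; move: xc; rewrite /ball /= distrC.
Qed.

Lemma inv_succ_lt (R : realType) (e : R) :
  0 < e -> exists N, forall n, (N <= n)%N -> n.+1%:R^-1 < e.
Proof.
move=> e0; exists (Num.bound e^-1) => n Nn.
rewrite invf_plt ?posrE ?ltr0n //.
apply: lt_le_trans (archi_boundP _) _; first by rewrite invr_ge0 ltW.
by rewrite ler_nat ltnW.
Qed.

(** Otherwise there are pairs of points at distance at most [1 / (n + 1)] whose images are more than
    [e] apart. A cluster point of the first components is one of the second components along the
    same indices, which contradicts continuity there. *)
Lemma heine_cantor (R : realType) (f : R -> R) (a b e : R) :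
  continuous f -> 0 < e ->
  exists2 d : R, 0 < d & forall x y, a <= x <= b -> a <= y <= b ->
    `|x - y| <= d -> `|f x - f y| <= e.
Proof.
move=> fc e0; have e20 : 0 < e / 2 by lra.
apply: contrapT => Nd.
have /choice[u uP] : forall n : nat, exists p : R * R,
    [/\ a <= p.1 <= b, a <= p.2 <= b, `|p.1 - p.2| <= n.+1%:R^-1 &
        e < `|f p.1 - f p.2|].
  move=> n; apply: contrapT => Np; apply: Nd; exists n.+1%:R^-1.
    by rewrite invr_gt0 ltr0n.
  move=> x y xab yab xy; rewrite leNgt; apply/negP => fxy.
  by apply: Np; exists (x, y).
have [|c _ cP] := @segment_cluster R a b (fun n => (u n).1).
  by move=> n; case: (uP n).
have /cvgrPdist_lt/(_ _ e20)/nbhs_ballP[d /= d0 dP] := fc c.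
have d20 : 0 < d / 2 by lra.
have [N NP] := inv_succ_lt d20.
have [n /NP nd und] := cP _ d20 N.
have [_ _ /le_lt_trans/(_ nd) u12 fu] := uP n.
have h1 : `|f c - f (u n).1| < e / 2.
  by apply: dP; rewrite /ball /= distrC; lra.
have h2 : `|f c - f (u n).2| < e / 2.
  apply: dP; rewrite /ball /=.
  by have := ler_distD (u n).1 c (u n).2; rewrite distrC in und; lra.
have := ler_distD (f c) (f (u n).1) (f (u n).2).
by rewrite (distrC (f (u n).1) (f c)); lra.
Qed.

(* A symbol without a global solution is interpreted by the zero function, so
   no soundness argument for dL is needed. *)
Lemma interp_continuous (R : realType) h : continuous (@interp R h).
Proof.
rewrite /interp; case: xgetP => [g _ [Y [_ Yd] gY]|_] t; last exact: cst_continuous.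
have -> : g = (fun s => Y s ord0) by apply/funext.
apply: differentiable_continuous; apply/derivable1_diffP.
by have [] := Yd t ord0.
Qed.

(** * Rational intervals and rational step functions *)

Lemma ratr_between (R : realType) (x y : R) :
  x < y -> exists q : rat, x < ratr q < y.
Proof. by move=> /rat_in_itvoo[q]; rewrite in_itv; exists q. Qed.

Lemma segment_in_itv (R : realType) (x y : R) :
  exists i, forall z, x <= z <= y -> itv R i z.
Proof.
(* The minimum and the maximum keep the rational interval nonempty even when [y < x]. *)
have [p /andP[_ p2]] : exists p : rat, Num.min x y - 1 < ratr p < Num.min x y.
  by apply: ratr_between; lra.
have [q /andP[q1 _]] : exists q : rat, Num.max x y < ratr q < Num.max x y + 1.
  by apply: ratr_between; lra.
have pq : p <= q.
  rewrite -(ler_rat R); move: p2 q1; rewrite lt_min gt_max.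
  by move=> /andP[px _] /andP[xq _]; lra.
exists (MkIQ pq) => z /andP[xz zy]; rewrite /itv /=.
by move: p2 q1; rewrite lt_min gt_max => /andP[? _] /andP[_ ?]; lra.
Qed.

(** The extreme value theorem bounds [f] on the interval; [z] is the margin that an enclosure leaves
    around the values of a function symbol. *)
Lemma continuous_image_in_itv (R : realType) (f : R -> R) (i : IQ) :
  continuous f -> exists j, forall x z, itv R i x -> -1 <= z <= 1 ->
    itv R j (f x + z).
Proof.
move=> fc.
have lh : ratr (lo i) <= (ratr (hi i) : R) by rewrite ler_rat lo_le_hi.
have [m _ mP] := EVT_min lh (continuous_subspaceT fc).
have [M _ MP] := EVT_max lh (continuous_subspaceT fc).
have [j jP] := segment_in_itv (f m - 1) (f M + 1).
exists j => x z xi z1; apply: jP.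
by have := mP x; have := MP x; rewrite in_itv /= xi => /(_ isT) ? /(_ isT) ?; lra.
Qed.

(** A decision list: the guards exclude each other and leave no gap, so the graph is total and
    single-valued for every list, sorted or not. *)
Fixpoint step_fml (s : seq (rat * rat)) : fml :=
  match s with
  | [::] => FCmp Eq (TVar 1) (TCst 0)
  | (c, v) :: s' =>
      FOr (FAnd (FCmp Le (TVar 0) (TCst c)) (FCmp Eq (TVar 1) (TCst v)))
          (FAnd (FCmp Gt (TVar 0) (TCst c)) (step_fml s'))
  end.

Fixpoint step_fun (R : realType) (s : seq (rat * rat)) (x : R) : R :=
  match s with
  | [::] => 0
  | (c, v) :: s' => if x <= ratr c then ratr v else step_fun s' x
  end.

Lemma graph_step (R : realType) s (x v : R) :
  graph (step_fml s) x v <-> v = step_fun s x.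
Proof.
rewrite /graph; elim: s => [|[c u] s IH] /=; rewrite {1}/upd /=.
  by rewrite rmorph0.
rewrite {1 2}/upd /= {1}/upd /=; case: (leP x (ratr c)) => xc; split.
- by case=> [[]//|[]].
- by move=> ->; left.
- by case=> [[]//|[_ /IH]].
- by move=> /IH; right.
Qed.

Lemma step_fml_defines (R : realType) s : defines_function R (step_fml s).
Proof.
split.
- by elim: s => [|[c v] s IH] //=.
- elim: s => [|[c v] s IH] z; rewrite /= !inE; first by move=> ->; rewrite orbT.
  by case/or4P => [->|->|->|/IH]; rewrite ?orbT // !inE.
- move=> x; exists (step_fun s x); split; first exact/graph_step.
  by move=> v /graph_step.
Qed.

Lemma fun_of_step (R : realType) s (x : R) : fun_of (step_fml s) x = step_fun s x.
Proof. by apply: xget_unique => [|y /graph_step//]; apply/graph_step. Qed.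

(** Uniform continuity yields a rational mesh [d] on which [f] varies by at most [e / 2]. On each
    cell the step is a rational within [e / 2] of the value at the left endpoint. *)
Lemma step_approximation (R : realType) (f : R -> R) (i : IQ) (e : R) :
  continuous f -> 0 < e ->
  exists s, forall x, itv R i x -> `|step_fun s x - f x| <= e.
Proof.
move=> fc e0; have e20 : 0 < e / 2 by lra.
have [d' d'0 d'P] := heine_cantor (ratr (lo i)) (ratr (hi i)) fc e20.
have [d /andP[d0 dd']] := ratr_between d'0.
have dP (x y : R) : itv R i x -> itv R i y -> `|x - y| <= ratr d ->
    `|f x - f y| <= e / 2.
  by move=> xi yi xy; apply: d'P => //; lra.
(* Induction on the number of cells that carry [a] strictly beyond [hi i]; for [N = 0] no point is
   left to approximate. *)
have H N : forall a : rat, lo i <= a -> ratr (hi i) < ratr a + N%:R * ratr d :> R ->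
    exists s, forall x : R, ratr a <= x <= ratr (hi i) -> `|step_fun s x - f x| <= e.
  elim: N => [|N IH] a la ha.
    by exists [::] => x xa; exfalso; lra.
  have [s sP] : exists s, forall x : R, ratr (a + d) <= x <= ratr (hi i) ->
      `|step_fun s x - f x| <= e.
    have dq0 : 0 <= d by rewrite -(ler_rat R) rmorph0 ltW.
    apply: IH; first by lra.
    by rewrite rmorphD /=; move: ha; rewrite -natr1; lra.
  have [v v1] : exists v : rat, f (ratr a) - e / 2 < ratr v < f (ratr a).
    by apply: ratr_between; lra.
  exists ((a + d, v) :: s) => x xa /=; rewrite rmorphD /= in sP *.
  have /andP[ax xh] := xa; move: v1 => /andP[v1 v2].
  case: (leP x (ratr a + ratr d)) => xad; last by apply: sP; rewrite (ltW xad).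
  have la' : ratr (lo i) <= (ratr a : R) by rewrite ler_rat.
  have ai : itv R i (ratr a) by rewrite /itv /= la' (le_trans ax).
  have xi : itv R i x by rewrite /itv /= xh (le_trans la').
  have : `|f x - f (ratr a)| <= e / 2 by apply: dP; rewrite // ler_norml; lra.
  by rewrite !ler_norml => /andP[h1 h2]; apply/andP; split; lra.
have := @archi_boundP R ((ratr (hi i) - ratr (lo i)) / ratr d).
rewrite divr_ge0 ?(ltW d0) ?subr_ge0 ?ler_rat ?lo_le_hi // => /(_ isT).
by rewrite ltr_pdivrMr // ltrBlDl => /(H _ _ (lexx _)).
Qed.

(** * Coincidence lemmas and the meaning of [near_value] *)

Lemma fresh_gt s x : x \in s -> (x < fresh s)%N.
Proof. by move=> xs; rewrite /fresh ltnS; exact: leq_bigmax_seq. Qed.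

Lemma fresh_notin s : fresh s \notin s.
Proof. by apply/negP => /fresh_gt; rewrite ltnn. Qed.

Lemma tval_ext (R : realType) (w w' : state R) t :
  {in tvars t, w =1 w'} -> tval w t = tval w' t.
Proof.
elim: t => [x|c|t1 IH1 t2 IH2|t1 IH1 t2 IH2|f e IH] //= ww'.
- by apply: ww'; rewrite inE.
- by rewrite IH1 ?IH2 // => x xt; apply: ww'; rewrite mem_cat xt ?orbT.
- by rewrite IH1 ?IH2 // => x xt; apply: ww'; rewrite mem_cat xt ?orbT.
- by rewrite IH.
Qed.

Lemma tval_upd (R : realType) (w : state R) x v t :
  x \notin tvars t -> tval (upd w x v) t = tval w t.
Proof.
move=> xt; apply: tval_ext => y yt; rewrite /upd.
by case: eqP => // yx; rewrite -yx yt in xt.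
Qed.

Lemma sat_fol_ext (R : realType) P (w w' : state R) :
  fol P -> {in fv P, w =1 w'} -> sat w P <-> sat w' P.
Proof.
elim: P w w' => //= [c t u|P IHP Q IHQ|P IHP Q IHQ|P IHP|P IHP Q IHQ|x P IHP|x P IHP]
  w w' fP ww'.
- rewrite (@tval_ext _ w w' t) 1?(@tval_ext _ w w' u) // => x xt; apply: ww';
  by rewrite mem_cat xt ?orbT.
- have /andP[fP1 fQ] := fP.
  by rewrite (IHP w w') 1?(IHQ w w') // => x xt; apply: ww'; rewrite mem_cat xt ?orbT.
- have /andP[fP1 fQ] := fP.
  by rewrite (IHP w w') 1?(IHQ w w') // => x xt; apply: ww'; rewrite mem_cat xt ?orbT.
- by rewrite (IHP w w').
- have /andP[fP1 fQ] := fP.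
  by rewrite (IHP w w') 1?(IHQ w w') // => x xt; apply: ww'; rewrite mem_cat xt ?orbT.
- have H v : sat (upd w x v) P <-> sat (upd w' x v) P.
    apply: IHP => // y yP; rewrite /upd; case: eqP => // /eqP yx.
    by apply: ww'; rewrite mem_filter yx.
  by split=> h v; apply/H.
- have H v : sat (upd w x v) P <-> sat (upd w' x v) P.
    apply: IHP => // y yP; rewrite /upd; case: eqP => // /eqP yx.
    by apply: ww'; rewrite mem_filter yx.
  by split=> -[v /H]; exists v.
Qed.

Lemma fun_of_graph (R : realType) A (s v : R) :
  defines_function R A -> graph A s v <-> v = fun_of A s.
Proof.
move=> [_ _ /(_ s)[u [us uu]]].
have -> : fun_of A s = u by apply: xget_unique => // y /uu.
by split=> [/uu|->].
Qed.

(** The auxiliary variables [u] and [u.+1] lie above 0, 1, [x] and the variables of [e], so none of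
    the nested updates disturbs another. *)
Lemma sat_near_value (R : realType) A e d x (w : state R) :
  defines_function R A ->
  sat w (near_value A e d x) <-> `|w x - fun_of A (tval w e)| <= ratr d.
Proof.
move=> dA; have [fA vA _] := dA.
rewrite /near_value; set u := fresh _.
have gtu y : y \in [:: 0, 1, x & tvars e]%N -> (y < u)%N by exact: fresh_gt.
have u1 : (1 < u)%N by apply: gtu; rewrite !inE.
have xu : (x < u)%N by apply: gtu; rewrite !inE eqxx !orbT.
have ue : u \notin tvars e.
  by apply/negP=> h; have := gtu u; rewrite !inE h !orbT ltnn => /(_ isT).
have ve : u.+1 \notin tvars e.
  by apply/negP=> h; have := gtu u.+1; rewrite !inE h !orbT ltnNge leqnSn => /(_ isT).
pose w2 a b := upd (upd w u a) u.+1 b.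
have E y : (y < u)%N -> forall a b, w2 a b y = w y.
  by move=> yu a b; rewrite /w2 /upd !ltn_eqF // ltnW.
have Eu a b : w2 a b u = a by rewrite /w2 /upd eqxx ltn_eqF.
have Ev a b : w2 a b u.+1 = b by rewrite /w2 /upd eqxx.
have Ee a b : tval (w2 a b) e = tval w e by rewrite /w2 !tval_upd.
(* [graph] reads [A] in a state that is 0 away from the variables 0 and 1; the free variables of [A]
   are among these two, so the states agree where it matters. *)
have EA a b p q : sat (upd (upd (w2 a b) 0%N p) 1%N q) A <-> graph A p q.
  by apply: sat_fol_ext => // y /vA; rewrite !inE => /orP[]/eqP->.
have EN (b c : R) : (b + ratr (- d) <= c) /\ (c <= b + ratr d) <-> `|c - b| <= ratr d.
  rewrite rmorphN ler_distlC -(rwP andP); lra.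
pose w4 a b p q := upd (upd (w2 a b) 0%N p) 1%N q.
have E4 a b p q : [/\ w4 a b p q 0%N = p, w4 a b p q 1%N = q,
    w4 a b p q u = a & w4 a b p q u.+1 = b].
  have u0 := ltnW u1.
  by rewrite /w4; split; rewrite /upd -/(w2 a b) ?Eu ?Ev // !gtn_eqF // ltnS.
split=> [[a [b [[]]]]|wx].
  rewrite /= -/(w2 a b) Eu Ee Ev E // => -> [p [q []]].
  rewrite -/(w4 _ b p q); have [-> -> -> ->] := E4 (tval w e) b p q.
  by move=> [-> ->] /EA/(fun_of_graph _ _ dA) -> /EN.
set v := fun_of A (tval w e) in wx *.
exists (tval w e), v; rewrite /= -/(w2 _ _) Eu Ee Ev E //.
split; last exact/EN.
split=> //; exists (tval w e), v.
rewrite -/(w4 _ _ _ _); have [-> -> -> ->] := E4 (tval w e) v (tval w e) v.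
by split=> //; apply/EA/fun_of_graph.
Qed.

(** * Enclosures of terms and uniform continuity on a box *)

(** The clauses of [enclosure] localized to one term, so that they can be carried over to terms
    obtained by abstracting an application, which do not occur in the formula. *)
Definition term_enclosure (R : realType) (I : enclosure_map) (t : term) : Prop :=
  [/\ forall c, TCst c \in subterms t -> itv R (I (TCst c)) (ratr c),
      forall t1 t2, TAdd t1 t2 \in subterms t -> forall x y,
        itv R (I t1) x -> itv R (I t2) y -> itv R (I (TAdd t1 t2)) (x + y),
      forall t1 t2, TMul t1 t2 \in subterms t -> forall x y,
        itv R (I t1) x -> itv R (I t2) y -> itv R (I (TMul t1 t2)) (x * y) &
      forall f e, TApp f e \in subterms t -> forall x z,
        itv R (I e) x -> -1 <= z <= 1 -> itv R (I (TApp f e)) (interp f x + z)].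

Definition in_box (R : realType) (I : enclosure_map) (V : seq nat) (w : state R) :=
  forall x, x \in V -> itv R (I (TVar x)) (w x).

Lemma in_box_sub (R : realType) I V V' (w : state R) :
  {subset V <= V'} -> in_box I V' w -> in_box I V w.
Proof. by move=> VV' bw x /VV'/bw. Qed.

Lemma mem_subterms t : t \in subterms t.
Proof. by case: t => *; rewrite in_cons eqxx. Qed.

Lemma subterms_trans s t : s \in subterms t -> {subset subterms s <= subterms t}.
Proof.
elim: t => [x|c|t1 IH1 t2 IH2|t1 IH1 t2 IH2|f e IH] /=; rewrite in_cons.
- by move=> /orP[/eqP->|].
- by move=> /orP[/eqP->|].
- rewrite mem_cat => /or3P[/eqP-> //|/IH1 H|/IH2 H] u /H;
  by rewrite in_cons mem_cat => ->; rewrite ?orbT.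
- rewrite mem_cat => /or3P[/eqP-> //|/IH1 H|/IH2 H] u /H;
  by rewrite in_cons mem_cat => ->; rewrite ?orbT.
- by move=> /orP[/eqP-> //|/IH H] u /H; rewrite in_cons => ->; rewrite orbT.
Qed.

Lemma term_enclosure_sub (R : realType) I s t :
  {subset subterms s <= subterms t} -> term_enclosure R I t -> term_enclosure R I s.
Proof.
move=> st [h1 h2 h3 h4]; split.
- by move=> c /st; exact: h1.
- by move=> t1 t2 /st; exact: h2.
- by move=> t1 t2 /st; exact: h3.
- by move=> f e /st; exact: h4.
Qed.

Lemma subterms_add t1 t2 :
  {subset subterms t1 <= subterms (TAdd t1 t2)} /\
  {subset subterms t2 <= subterms (TAdd t1 t2)}.
Proof. by split=> u; rewrite /= in_cons mem_cat => ->; rewrite ?orbT. Qed.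

Lemma subterms_mul t1 t2 :
  {subset subterms t1 <= subterms (TMul t1 t2)} /\
  {subset subterms t2 <= subterms (TMul t1 t2)}.
Proof. by split=> u; rewrite /= in_cons mem_cat => ->; rewrite ?orbT. Qed.

Lemma subterms_app f e : {subset subterms e <= subterms (TApp f e)}.
Proof. by move=> u; rewrite /= in_cons => ->; rewrite orbT. Qed.

Lemma tval_enclosure (R : realType) I t (w : state R) :
  term_enclosure R I t -> in_box I (tvars t) w -> itv R (I t) (tval w t).
Proof.
elim: t => [x|c|t1 IH1 t2 IH2|t1 IH1 t2 IH2|f e IH] It bw.
- by apply: bw; rewrite inE.
- by case: It => + _ _ _; apply; exact: mem_subterms.
- have [s1 s2] := subterms_add t1 t2.
  have [_ + _ _] := It; apply; first exact: mem_subterms.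
    by apply: IH1 (term_enclosure_sub s1 It) (in_box_sub _ bw) => x; rewrite mem_cat => ->.
  by apply: IH2 (term_enclosure_sub s2 It) (in_box_sub _ bw) => x; rewrite mem_cat orbC => ->.
- have [s1 s2] := subterms_mul t1 t2.
  have [_ _ + _] := It; apply; first exact: mem_subterms.
    by apply: IH1 (term_enclosure_sub s1 It) (in_box_sub _ bw) => x; rewrite mem_cat => ->.
  by apply: IH2 (term_enclosure_sub s2 It) (in_box_sub _ bw) => x; rewrite mem_cat orbC => ->.
- have [_ _ _ +] := It; move=> /(_ f e (mem_subterms _) (tval w e) 0).
  rewrite addr0 /=; apply; last by apply/andP; split; lra.
  by apply: IH => //; exact: term_enclosure_sub (@subterms_app f e) It.
Qed.

Definition close_on (R : realType) (d : R) (V : seq nat) (w w' : state R) :=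
  forall x, x \in V -> `|w x - w' x| <= d.

Lemma close_on_min (R : realType) (d1 d2 : R) V1 V2 V (w w' : state R) :
  {subset V1 <= V} -> {subset V2 <= V} -> close_on (Num.min d1 d2) V w w' ->
  close_on d1 V1 w w' /\ close_on d2 V2 w w'.
Proof.
move=> V1V V2V ww'.
by split=> x xV; [have := ww' x (V1V x xV) | have := ww' x (V2V x xV)];
  rewrite le_min => /andP[].
Qed.

Lemma itv_bounded (R : realType) (i : IQ) :
  exists2 M : R, 0 < M & forall x, itv R i x -> `|x| <= M.
Proof.
exists (`|ratr (lo i)| + `|ratr (hi i)| + 1).
  by rewrite ltr_wpDl // addr_ge0.
move=> x /andP[lx xh]; rewrite ler_norml.
have := ler_norm (- (ratr (lo i) : R)); rewrite normrN.
have := ler_norm (ratr (hi i) : R).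
have := normr_ge0 (ratr (lo i) : R); have := normr_ge0 (ratr (hi i) : R).
by move: lx xh => *; apply/andP; split; lra.
Qed.

(** Moduli compose along the term: a sum halves the tolerance, a product also divides it by bounds
    of the enclosures of the factors, and an application uses [heine_cantor] on [I e], where the
    enclosure keeps the argument. *)
Lemma tval_unif_continuous (R : realType) I t (k : R) :
  term_enclosure R I t -> 0 < k ->
  exists2 d : R, 0 < d & forall w w' : state R,
    in_box I (tvars t) w -> in_box I (tvars t) w' -> close_on d (tvars t) w w' ->
    `|tval w t - tval w' t| <= k.
Proof.
elim: t k => [x|c|t1 IH1 t2 IH2|t1 IH1 t2 IH2|f e IH] k It k0.
- by exists k => // w w' _ _; apply; rewrite inE.
- by exists k => // w w' _ _ _; rewrite /= subrr normr0 ltW.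
- have [s1 s2] := subterms_add t1 t2; have k20 : 0 < k / 2 by lra.
  have [d1 d10 H1] := IH1 _ (term_enclosure_sub s1 It) k20.
  have [d2 d20 H2] := IH2 _ (term_enclosure_sub s2 It) k20.
  have S1 : {subset tvars t1 <= tvars (TAdd t1 t2)} by move=> x; rewrite mem_cat => ->.
  have S2 : {subset tvars t2 <= tvars (TAdd t1 t2)} by move=> x; rewrite mem_cat orbC => ->.
  exists (Num.min d1 d2) => [|w w' bw bw' ww' /=]; first by rewrite lt_min d10.
  have h1 := H1 w w' (in_box_sub S1 bw) (in_box_sub S1 bw').
  have h2 := H2 w w' (in_box_sub S2 bw) (in_box_sub S2 bw').
  have [/h1{}h1 /h2{}h2] := close_on_min S1 S2 ww'.
  rewrite opprD addrACA (le_trans (ler_normD _ _)) //.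
  by move: h1 h2 => *; lra.
- have [s1 s2] := subterms_mul t1 t2.
  have [M1 M10 B1] := itv_bounded R (I t1).
  have [M2 M20 B2] := itv_bounded R (I t2).
  have k10 : 0 < k / 2 / M2 by rewrite !divr_gt0.
  have k20 : 0 < k / 2 / M1 by rewrite !divr_gt0.
  have [d1 d10 H1] := IH1 _ (term_enclosure_sub s1 It) k10.
  have [d2 d20 H2] := IH2 _ (term_enclosure_sub s2 It) k20.
  have S1 : {subset tvars t1 <= tvars (TMul t1 t2)} by move=> x; rewrite mem_cat => ->.
  have S2 : {subset tvars t2 <= tvars (TMul t1 t2)} by move=> x; rewrite mem_cat orbC => ->.
  exists (Num.min d1 d2) => [|w w' bw bw' ww' /=]; first by rewrite lt_min d10.
  have h1 := H1 w w' (in_box_sub S1 bw) (in_box_sub S1 bw').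
  have h2 := H2 w w' (in_box_sub S2 bw) (in_box_sub S2 bw').
  have [/h1{}h1 /h2{}h2] := close_on_min S1 S2 ww'.
  have b1 := B1 _ (tval_enclosure (term_enclosure_sub s1 It) (in_box_sub S1 bw)).
  have b2 := B2 _ (tval_enclosure (term_enclosure_sub s2 It) (in_box_sub S2 bw')).
  have -> : tval w t1 * tval w t2 - tval w' t1 * tval w' t2 =
    tval w t1 * (tval w t2 - tval w' t2) + (tval w t1 - tval w' t1) * tval w' t2 by ring.
  rewrite (le_trans (ler_normD _ _)) // !normrM (splitr k); apply: lerD.
    have -> : k / 2 = M1 * (k / 2 / M1) by rewrite [RHS]mulrC divfK // gt_eqF.
    exact: ler_pM.
  have -> : k / 2 = (k / 2 / M2) * M2 by rewrite divfK // gt_eqF.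
  exact: ler_pM.
- have Ie := term_enclosure_sub (@subterms_app f e) It.
  have [c c0 H] :=
    heine_cantor (ratr (lo (I e))) (ratr (hi (I e))) (@interp_continuous R f) k0.
  have [d d0 He] := IH _ Ie c0.
  exists d => // w w' bw bw' ww'; apply: H; last exact: He.
    exact: tval_enclosure Ie bw.
  exact: tval_enclosure Ie bw'.
Qed.

(** * Abstraction of an innermost application and perturbed values of atoms *)

Lemma tsubst_id (x : nat) s t : x \notin tvars t -> tsubst (subst1 x s) t = t.
Proof.
elim: t => [y|c|t1 IH1 t2 IH2|t1 IH1 t2 IH2|f e IH] //=.
- by rewrite mem_seq1 /subst1 /upd eq_sym => /negPf->.
- by rewrite mem_cat negb_or => /andP[/IH1-> /IH2->].
- by rewrite mem_cat negb_or => /andP[/IH1-> /IH2->].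
- by move=> /IH->.
Qed.

Lemma subst1_eq x s : subst1 x s x = s.
Proof. by rewrite /subst1 /upd eqxx. Qed.

Lemma abstract_termK s (x : nat) t :
  x \notin tvars t -> tsubst (subst1 x s) (abstract_term s x t) = t.
Proof.
elim: t => [y|c|t1 IH1 t2 IH2|t1 IH1 t2 IH2|f e IH] /= xt;
  case: eqP => [->|_] /=; rewrite ?subst1_eq //.
- by rewrite -[RHS](tsubst_id (x := x) s).
- by move: xt; rewrite mem_cat negb_or => /andP[/IH1-> /IH2->].
- by move: xt; rewrite mem_cat negb_or => /andP[/IH1-> /IH2->].
- by rewrite IH.
Qed.

(** Substituting [s] back for the fresh [x] undoes the abstraction on subterms as well. Hence
    enclosures and approximations given on [t] can be pulled back to the abstracted term. *)
Lemma subterms_abstract s (x : nat) t u :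
  x \notin tvars t -> u \in subterms (abstract_term s x t) ->
  tsubst (subst1 x s) u \in subterms t.
Proof.
(* The root is settled by [abstract_termK], which leaves only the proper subterms to the
   induction. *)
have top v : x \notin tvars v ->
    (u \in behead (subterms (abstract_term s x v)) ->
      tsubst (subst1 x s) u \in subterms v) ->
    u \in subterms (abstract_term s x v) -> tsubst (subst1 x s) u \in subterms v.
  move=> xv H; have -> : subterms (abstract_term s x v) =
      abstract_term s x v :: behead (subterms (abstract_term s x v)).
    by case: (abstract_term s x v).
  by rewrite in_cons => /predU1P[->|//]; rewrite abstract_termK // mem_subterms.
elim: t => [y|c|t1 IH1 t2 IH2|t1 IH1 t2 IH2|f e IH] xt; apply: (top) => //=;
  case: ifP => _ //=.
- move: xt; rewrite /= !mem_cat negb_or in_cons mem_cat.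
  by move=> /andP[/IH1 H1 /IH2 H2] /orP[/H1|/H2] ->; rewrite !orbT.
- move: xt; rewrite /= !mem_cat negb_or in_cons mem_cat.
  by move=> /andP[/IH1 H1 /IH2 H2] /orP[/H1|/H2] ->; rewrite !orbT.
- by move=> /(IH xt); rewrite in_cons => ->; rewrite orbT.
Qed.

Lemma tvars_abstract s (x : nat) t :
  {subset tvars (abstract_term s x t) <= x :: tvars t}.
Proof.
have V z v : z \in tvars (TVar x) -> z \in x :: v.
  by rewrite mem_seq1 in_cons => ->.
elim: t => [y|c|t1 IH1 t2 IH2|t1 IH1 t2 IH2|f e IH] /= z; case: eqP => _; try exact: V.
- by move=> zy; rewrite in_cons zy orbT.
- by [].
- rewrite in_cons /= !mem_cat => /orP[/IH1|/IH2]; rewrite in_cons => /orP[->|->] //;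
  by rewrite !orbT.
- rewrite in_cons /= !mem_cat => /orP[/IH1|/IH2]; rewrite in_cons => /orP[->|->] //;
  by rewrite !orbT.
- by move=> /IH; rewrite in_cons.
Qed.

Lemma tval_abstract (R : realType) s (x : nat) t (w : state R) :
  x \notin tvars t ->
  tval (upd w x (tval w s)) (abstract_term s x t) = tval w t.
Proof.
elim: t => [y|c|t1 IH1 t2 IH2|t1 IH1 t2 IH2|f e IH] /= xt; case: eqP => [<-|_] /=;
  rewrite ?eqxx //.
- by rewrite /upd eqxx.
- exact: (@tval_upd _ w x _ (TVar y)).
- by rewrite /upd eqxx.
- by rewrite /upd eqxx.
- by move: xt; rewrite mem_cat negb_or => /andP[/IH1-> /IH2->].
- by rewrite /upd eqxx.
- by move: xt; rewrite mem_cat negb_or => /andP[/IH1-> /IH2->].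
- by rewrite /upd eqxx.
- by rewrite IH.
Qed.

Lemma innermost_subterm t f e : innermost t = Some (f, e) -> TApp f e \in subterms t.
Proof.
elim: t => [y|c|t1 IH1 t2 IH2|t1 IH1 t2 IH2|g u IH] //=.
- case: innermost IH1 => [p|_ /IH2 H]; last by rewrite in_cons mem_cat H !orbT.
  by move=> /[apply] H; rewrite in_cons mem_cat H !orbT.
- case: innermost IH1 => [p|_ /IH2 H]; last by rewrite in_cons mem_cat H !orbT.
  by move=> /[apply] H; rewrite in_cons mem_cat H !orbT.
- case: innermost IH => [p|_ [-> ->]]; last by rewrite in_cons eqxx.
  by move=> /[apply] H; rewrite in_cons H orbT.
Qed.

(* The values which t can take when its function applications are replaced, one
   after another, by values within d of their approximations. *)
Fixpoint reach (R : realType) (d : rat) (k : nat) (F : Defs.approximation) (t : term)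
    (w : state R) (z : R) : Prop :=
  match k, innermost t with
  | k'.+1, Some (f, e) =>
      let x := fresh (tvars t) in
      exists2 v, `|v - fun_of (F (TApp f e)) (tval w e)| <= ratr d &
        reach d k' (F \o tsubst (subst1 x (TApp f e)))
          (abstract_term (TApp f e) x t) (upd w x v) z
  | _, _ => z = tval w t
  end.

Definition accurate (R : realType) (I : enclosure_map) (d : rat)
    (F : Defs.approximation) (t : term) : Prop :=
  forall f e, TApp f e \in subterms t ->
    defines_function R (F (TApp f e)) /\
    forall y : R, itv R (I e) y ->
      `|fun_of (F (TApp f e)) y - interp f y| <= ratr d.

(** The enclosure is read through the back substitution, so each clause for the new term is a clause
    for a subterm of [t], and [x] inherits the interval of [s]. *)
Lemma enclosure_abstract (R : realType) I s (x : nat) t :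
  x \notin tvars t -> term_enclosure R I t ->
  term_enclosure R (I \o tsubst (subst1 x s)) (abstract_term s x t).
Proof.
move=> xt [h1 h2 h3 h4]; have S := @subterms_abstract s x t _ xt; split.
- by move=> c /S /h1.
- by move=> t1 t2 /S /h2.
- by move=> t1 t2 /S /h3.
- by move=> f e /S /h4.
Qed.

Lemma accurate_abstract (R : realType) I d F s (x : nat) t :
  x \notin tvars t -> accurate R I d F t ->
  accurate R (I \o tsubst (subst1 x s)) d (F \o tsubst (subst1 x s))
    (abstract_term s x t).
Proof. by move=> xt h f e /(subterms_abstract xt) /h. Qed.

Lemma in_box_abstract (R : realType) I s (x : nat) t (w : state R) v :
  in_box I (tvars t) w -> itv R (I s) v ->
  in_box (I \o tsubst (subst1 x s)) (tvars (abstract_term s x t)) (upd w x v).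
Proof.
move=> bw sv y /tvars_abstract; rewrite in_cons /= /subst1 /upd.
by case: eqP => // _ /bw.
Qed.

Lemma tvars_subterm s t : s \in subterms t -> {subset tvars s <= tvars t}.
Proof.
elim: t => [y|c|t1 IH1 t2 IH2|t1 IH1 t2 IH2|g u IH] /=; rewrite in_cons.
- by move=> /predU1P[->|].
- by move=> /predU1P[->|].
- rewrite mem_cat => /predU1P[-> //|/orP[/IH1|/IH2] H] z /H;
  by rewrite mem_cat => ->; rewrite ?orbT.
- rewrite mem_cat => /predU1P[-> //|/orP[/IH1|/IH2] H] z /H;
  by rewrite mem_cat => ->; rewrite ?orbT.
- by move=> /predU1P[->|].
Qed.

Lemma app_arg_enclosure (R : realType) I f e t (w : state R) :
  TApp f e \in subterms t -> term_enclosure R I t -> in_box I (tvars t) w ->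
  itv R (I e) (tval w e).
Proof.
move=> fet It bw; apply: tval_enclosure; last first.
  by apply: in_box_sub bw; exact: (tvars_subterm fet).
apply: term_enclosure_sub It => u ue; apply: subterms_trans fet _ _.
exact: subterms_app.
Qed.

(** The exact value of the function may be chosen at every stage: the enclosure keeps the argument
    in [I e], where the approximation is within [d] of it. *)
Lemma reach_tval (R : realType) d k F I t (w : state R) :
  term_enclosure R I t -> accurate R I d F t -> in_box I (tvars t) w ->
  reach d k F t w (tval w t).
Proof.
elim: k F I t w => [|k IH] F I t w It Ft bw //=.
case E: (innermost t) => [[f e]|//]; have fet := innermost_subterm E.
have xt := fresh_notin (tvars t); have eI := app_arg_enclosure fet It bw.
exists (interp f (tval w e)); first by rewrite distrC; apply (Ft f e fet).2.
rewrite -(tval_abstract (TApp f e) w xt).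
apply: (IH _ _ _ _ (enclosure_abstract _ xt It) (accurate_abstract xt Ft)).
apply: in_box_abstract bw _; rewrite -[X in itv R _ X]addr0.
by case: It => _ _ _; apply => //; lra.
Qed.

(** A value chosen at one stage is within [2 * d] of the exact one. The remaining stages are
    controlled by induction, at the state holding the chosen value; replacing that value by the
    exact one is controlled by uniform continuity. *)
Lemma reach_close (R : realType) k I t (c : R) :
  term_enclosure R I t -> 0 < c ->
  exists2 b : R, 0 < b & forall (d : rat) F (w : state R) z,
    (ratr d : R) <= 1 / 2 -> ratr d <= b -> accurate R I d F t ->
    in_box I (tvars t) w -> reach d k F t w z -> `|z - tval w t| <= c.
Proof.
elim: k I t c => [|k IH] I t c It c0 /=.
  by exists 1 => // d F w z _ _ _ _ ->; rewrite subrr normr0 ltW.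
case E: (innermost t) => [[f e]|]; last first.
  by exists 1 => // d F w z _ _ _ _ ->; rewrite subrr normr0 ltW.
have fet := innermost_subterm E; have xt := fresh_notin (tvars t).
set x := fresh _ in xt *; set s := TApp f e.
have c20 : 0 < c / 2 by lra.
have I' := enclosure_abstract s xt It.
have [b1 b10 H1] := IH _ _ _ I' c20.
have [h h0 H2] := tval_unif_continuous I' c20.
(* [b1] serves the remaining stages; [h / 2] makes the deviation [2 * d] at most the modulus [h]. *)
exists (Num.min b1 (h / 2)) => [|d F w z d2]; first by rewrite lt_min b10; lra.
rewrite le_min => /andP[db1 dh] Ft bw [v vF].
have [_ /(_ _ (app_arg_enclosure fet It bw)) Fe] := Ft f e fet.
have vf : `|v - interp f (tval w e)| <= 2 * ratr d.
  have := ler_distD (fun_of (F (TApp f e)) (tval w e)) v (interp f (tval w e)).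
  lra.
have sI r : -1 <= r <= 1 -> itv R (I s) (interp f (tval w e) + r).
  have eI := app_arg_enclosure fet It bw.
  by case: It => _ _ _ H r1; apply: H fet _ _ eI r1.
(* Since [2 * d <= 1], the chosen value stays inside the margin [[-1, 1]] of the enclosure, so the
   induction applies to the updated state. *)
have sv : itv R (I s) v.
  rewrite -[v](subrK (interp f (tval w e))) addrC; apply: sI.
  by move: vf; rewrite ler_norml => /andP[? ?]; apply/andP; split; lra.
have s0 : itv R (I s) (tval w s).
  by rewrite -[X in itv R _ X]addr0; apply: sI; apply/andP; split; lra.
have bv := in_box_abstract (x := x) bw sv; have b0 := in_box_abstract (x := x) bw s0.
move=> /(H1 _ _ _ _ d2 db1 (accurate_abstract xt Ft) bv) zv.
have : close_on h (tvars (abstract_term s x t)) (upd w x v) (upd w x (tval w s)).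
  move=> y _; rewrite /upd; case: eqP => _; last by rewrite subrr normr0 ltW.
  by rewrite (le_trans vf) //; lra.
move=> /(H2 _ _ bv b0); rewrite (tval_abstract s w xt) => vt.
have := ler_distD (tval (upd w x v) (abstract_term s x t)) z (tval w t).
lra.
Qed.

(** The nested quantifiers of the perturbation range over exactly the choices made by [reach]. *)
Lemma sat_perturb_atom (R : realType) q d r k F t (w : state R) :
  (forall f e, TApp f e \in subterms t -> defines_function R (F (TApp f e))) ->
  sat w (perturb_atom q d r k F t) <->
  match q with
  | QAll => forall z, reach d k F t w z -> cmp_sem r z 0
  | QEx => exists2 z, reach d k F t w z & cmp_sem r z 0
  end.
Proof.
elim: k F t w => [|k IH] F t w Ft /=.
  rewrite rmorph0; case: q; first by split=> [h z -> //|]; apply.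
  by split=> [|[z ->]//]; exists (tval w t).
case E: (innermost t) => [[f e]|]; last first.
  rewrite /= rmorph0; case: q IH => _; first by split=> [h z -> //|]; apply.
  by split=> [|[z ->]//]; exists (tval w t).
have fet := innermost_subterm E; have xt := fresh_notin (tvars t).
set x := fresh _ in xt *; set s := TApp f e.
have xe : x \notin tvars e by apply: contra xt; exact: (tvars_subterm fet).
have {}IH v := IH (F \o tsubst (subst1 x s)) (abstract_term s x t) (upd w x v)
  (fun g u gu => Ft _ _ (subterms_abstract xt gu)).
have N v : sat (upd w x v) (near_value (F s) e d x) <->
    `|v - fun_of (F s) (tval w e)| <= ratr d.
  by rewrite sat_near_value ?tval_upd ?/upd ?eqxx //; exact: Ft.
case: q IH => IH /=; split.
- by move=> h z [v /N /h /IH]; apply.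
- by move=> h v /N vF; apply/IH => z vz; apply: h; exists v.
- by move=> [v [/N vF /IH[z vz z0]]]; exists z => //; exists v.
- by move=> [z [v vF vz] z0]; exists v; split; [exact/N|apply/IH; exists z].
Qed.

(** * Satisfaction over arbitrary atoms, and duality *)

(** The meaning of the atoms is a parameter, so that the exact, perturbed, relaxed and negated
    readings of one formula become comparable. *)
Fixpoint bsat (R : realType) (A : term -> state R -> Prop) (P : bfml)
    (w : state R) : Prop :=
  match P with
  | BAtom _ t => A t w
  | BAnd P Q => bsat A P w /\ bsat A Q w
  | BOr P Q => bsat A P w \/ bsat A Q w
  | BQ QAll y a b P =>
      forall v, tval w a <= v <= tval w b -> bsat A P (upd w y v)
  | BQ QEx y a b P =>
      exists2 v, tval w a <= v <= tval w b & bsat A P (upd w y v)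
  end.

Fixpoint atoms (P : bfml) : seq term :=
  match P with
  | BAtom _ t => [:: t]
  | BAnd P Q | BOr P Q => atoms P ++ atoms Q
  | BQ _ _ _ _ P => atoms P
  end.

Fixpoint enclosed (R : realType) (I : enclosure_map) (P : bfml) : Prop :=
  match P with
  | BAtom _ t => term_enclosure R I t
  | BAnd P Q | BOr P Q => enclosed R I P /\ enclosed R I Q
  | BQ _ y a b P =>
      [/\ y \notin tvars a ++ tvars b, term_enclosure R I a, term_enclosure R I b,
          itv R (I a) `|` itv R (I b) `<=` itv R (I (TVar y)) &
          enclosed R I P]
  end.

(** The interval condition of [normal_form], stated at a single state instead of through a
    precondition. *)
Fixpoint genuine (R : realType) (P : bfml) (w : state R) : Prop :=
  match P with
  | BAtom _ _ => True
  | BAnd P Q | BOr P Q => genuine P w /\ genuine Q w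
  | BQ _ y a b P => tval w a <= tval w b /\
      forall v, tval w a <= v <= tval w b -> genuine P (upd w y v)
  end.

Lemma fv_quant q y a b (P : bfml) :
  fv (BQ q y a b P) =
  [seq z <- (tvars a ++ [:: y] ++ [:: y] ++ tvars b) ++ fv P | z != y].
Proof. by case: q; rewrite /= -!catA. Qed.

Lemma fv_quant_sub q y a b (P : bfml) : y \notin tvars a ++ tvars b ->
  [/\ {subset tvars a <= fv (BQ q y a b P)}, {subset tvars b <= fv (BQ q y a b P)} &
      {subset fv P <= y :: fv (BQ q y a b P)}].
Proof.
rewrite mem_cat negb_or => /andP[ya yb]; split=> x xa; rewrite fv_quant.
- rewrite mem_filter !mem_cat xa andbT.
  by apply: contraNneq ya => <-.
- rewrite mem_filter !mem_cat xa !orbT andbT.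
  by apply: contraNneq yb => <-.
- by rewrite in_cons mem_filter !mem_cat xa !orbT andbT orbN.
Qed.

Lemma in_box_quant (R : realType) I q y a b (P : bfml) (w : state R) v :
  enclosed R I (BQ q y a b P) -> in_box I (fv (BQ q y a b P)) w ->
  tval w a <= v <= tval w b -> in_box I (fv P) (upd w y v).
Proof.
move=> [yab Ia Ib Iy _] bw /andP[av vb] x.
have [sa sb /[apply]] := fv_quant_sub q P yab.
rewrite in_cons /upd; case: eqP => [-> _|_ /bw//].
have := Iy _ (or_introl (tval_enclosure Ia (in_box_sub sa bw))).
have := Iy _ (or_intror (tval_enclosure Ib (in_box_sub sb bw))).
by rewrite /itv /= => /andP[_ bI] /andP[aI _]; rewrite (le_trans aI av) (le_trans vb bI).
Qed.

(** Formulas are positive in their atoms. Comparing the atoms on the box suffices, because the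
    enclosure keeps every bound variable in its interval. *)
Lemma bsat_imp (R : realType) (A B : term -> state R -> Prop) I P w :
  enclosed R I P -> in_box I (fv P) w ->
  (forall t w, t \in atoms P -> in_box I (tvars t) w -> A t w -> B t w) ->
  bsat A P w -> bsat B P w.
Proof.
elim: P w => [r t|P IHP Q IHQ|P IHP Q IHQ|q y a b P IH] w IP bw AB.
- by apply: AB; rewrite ?inE //=; apply: in_box_sub bw => x xt; rewrite mem_cat xt.
- have [IP1 IQ] := IP; case=> hP hQ; split.
    apply: IHP hP => //; first by apply: in_box_sub bw => x xt; rewrite mem_cat xt.
    by move=> t w' h; apply: AB; rewrite mem_cat h.
  apply: IHQ hQ => //; first by apply: in_box_sub bw => x xt; rewrite mem_cat xt orbT.
  by move=> t w' h; apply: AB; rewrite mem_cat h orbT.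
- have [IP1 IQ] := IP; case=> [hP|hQ]; [left|right].
    apply: IHP hP => //; first by apply: in_box_sub bw => x xt; rewrite mem_cat xt.
    by move=> t w' h; apply: AB; rewrite mem_cat h.
  apply: IHQ hQ => //; first by apply: in_box_sub bw => x xt; rewrite mem_cat xt orbT.
  by move=> t w' h; apply: AB; rewrite mem_cat h orbT.
- have IP' : enclosed R I P by case: IP.
  case: q IP bw AB => IP bw AB.
    by move=> h v vab; apply: IH (h v vab); rewrite //; exact: in_box_quant IP bw vab.
  move=> [v vab hv]; exists v => //.
  by apply: IH hv; rewrite //; exact: in_box_quant IP bw vab.
Qed.

(** Negation pushed inwards, with the atoms left alone: their negation is carried by the parameter
    [A] of [bsat]. *)
Fixpoint dual (P : bfml) : bfml :=
  match P with
  | BAtom r t => BAtom r t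
  | BAnd P Q => BOr (dual P) (dual Q)
  | BOr P Q => BAnd (dual P) (dual Q)
  | BQ QAll y a b P => BQ QEx y a b (dual P)
  | BQ QEx y a b P => BQ QAll y a b (dual P)
  end.

Lemma bsat_dual (R : realType) (A : term -> state R -> Prop) P w :
  bsat (fun t w => ~ A t w) (dual P) w <-> ~ bsat A P w.
Proof.
elim: P w => [r t|P IHP Q IHQ|P IHP Q IHQ|[] y a b P IH] w //=.
- by rewrite IHP IHQ not_andP.
- by rewrite IHP IHQ not_orP.
- split=> [[v vab /IH Pv] h|h]; first exact: Pv (h v vab).
  apply: contrapT => h'; apply: h => v vab; apply: contrapT => Pv.
  by apply: h'; exists v => //; apply/IH.
- split=> [h [v vab Pv]|h v vab]; first by case/IH: (h v vab).
  by apply/IH => Pv; apply: h; exists v.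
Qed.

Lemma fv_dual P : fv (dual P) = fv P.
Proof.
by elim: P => [r t|P IHP Q IHQ|P IHP Q IHQ|[] y a b P IH] //=; rewrite ?IHP ?IHQ ?IH.
Qed.

Lemma enclosed_dual (R : realType) I P : enclosed R I P -> enclosed R I (dual P).
Proof.
elim: P => [r t|P IHP Q IHQ|P IHP Q IHQ|[] y a b P IH] //=.
- by move=> [/IHP ? /IHQ ?].
- by move=> [/IHP ? /IHQ ?].
- by move=> [? ? ? ? /IH].
- by move=> [? ? ? ? /IH].
Qed.

Lemma genuine_dual (R : realType) P (w : state R) : genuine P w -> genuine (dual P) w.
Proof.
elim: P w => [r t|P IHP Q IHQ|P IHP Q IHQ|[] y a b P IH] w //=.
- by move=> [/IHP ? /IHQ ?].
- by move=> [/IHP ? /IHQ ?].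
- by move=> [? h]; split=> // v /h /IH.
- by move=> [? h]; split=> // v /h /IH.
Qed.

(* With s = 1 these are the atoms t >= - e; with s = -1 the negations of t > e. *)
Definition above (R : realType) (s e : R) (t : term) (w : state R) :=
  - e <= s * tval w t.

(** * Stability of satisfaction under shifts of the state and limits of relaxations *)

(** The projection of [v] onto [[a', b']] moves it by no more than the displacement of the endpoint
    that it crosses. *)
Lemma clamp (R : realType) (a b a' b' v h : R) :
  a <= v <= b -> a' <= b' -> `|a - a'| <= h -> `|b - b'| <= h ->
  exists2 v', a' <= v' <= b' & `|v - v'| <= h.
Proof.
move=> /andP[av vb] ab' ha hb.
have h0 : 0 <= h by apply: le_trans ha.
have [va|a'v] := ltP v a'; first exists a'; rewrite ?lexx ?ab' //.
  by move: ha; rewrite !ler_norml; lra.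
have [bv|vb'] := ltP b' v; first exists b'; rewrite ?lexx ?ab' //.
  by move: hb; rewrite !ler_norml; lra.
by exists v; rewrite ?a'v ?vb' // subrr normr0.
Qed.

Lemma close_on_upd (R : realType) (d : R) (y : nat) V V' (w w' : state R) v v' :
  {subset V <= y :: V'} -> close_on d V' w w' -> `|v - v'| <= d ->
  close_on d V (upd w y v) (upd w' y v').
Proof.
by move=> VV' ww' vv' x /VV'; rewrite in_cons /upd; case: eqP => // _ /ww'.
Qed.

(** A small move of the state costs a relaxation by [k], whatever [e] is. At atoms this is uniform
    continuity; at quantifiers the interval moves only slightly, and values are clamped from one
    interval into the other. *)
Lemma bsat_shift (R : realType) I P (s k : R) :
  `|s| = 1 -> enclosed R I P -> 0 < k ->
  exists2 d : R, 0 < d & forall (w w' : state R) e,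
    in_box I (fv P) w -> in_box I (fv P) w' -> genuine P w -> genuine P w' ->
    close_on d (fv P) w w' -> bsat (above s e) P w -> bsat (above s (e + k)) P w'.
Proof.
move=> s1; elim: P k => [r t|P IHP Q IHQ|P IHP Q IHQ|q y a b P IH] k IP k0.
- have [d d0 H] := tval_unif_continuous IP k0.
  exists d => // w w' e; rewrite /= cats0 /above => bw bw' _ _ /(H _ _ bw bw').
  rewrite -[X in X <= _ -> _]mul1r -s1 -normrM mulrBr ler_norml => ? ?; lra.
- have [[IP1 IQ] SP SQ] : [/\ enclosed R I P /\ enclosed R I Q,
    {subset fv P <= fv (BAnd P Q)} & {subset fv Q <= fv (BAnd P Q)}].
    by split=> // x h; rewrite mem_cat h ?orbT.
  have [d1 d10 H1] := IHP k IP1 k0; have [d2 d20 H2] := IHQ k IQ k0.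
  exists (Num.min d1 d2) => [|w w' e bw bw' [g1 g2] [g1' g2'] ww' [hP hQ]].
    by rewrite lt_min d10.
  have [c1 c2] := close_on_min SP SQ ww'; split.
    by apply: H1 c1 hP; rewrite //; exact: in_box_sub SP _.
  by apply: H2 c2 hQ; rewrite //; exact: in_box_sub SQ _.
- have [[IP1 IQ] SP SQ] : [/\ enclosed R I P /\ enclosed R I Q,
    {subset fv P <= fv (BOr P Q)} & {subset fv Q <= fv (BOr P Q)}].
    by split=> // x h; rewrite mem_cat h ?orbT.
  have [d1 d10 H1] := IHP k IP1 k0; have [d2 d20 H2] := IHQ k IQ k0.
  exists (Num.min d1 d2) => [|w w' e bw bw' [g1 g2] [g1' g2'] ww'].
    by rewrite lt_min d10.
  have [c1 c2] := close_on_min SP SQ ww'; case=> [hP|hQ]; [left|right].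
    by apply: H1 c1 hP; rewrite //; exact: in_box_sub SP _.
  by apply: H2 c2 hQ; rewrite //; exact: in_box_sub SQ _.
- have [yab Ia Ib _ IP'] := IP; have [d d0 H] := IH k IP' k0.
  have [sa sb sP] := fv_quant_sub q P yab.
  have [da da0 Ha] := tval_unif_continuous Ia d0.
  have [db db0 Hb] := tval_unif_continuous Ib d0.
  (* [da] and [db] keep the two endpoints within [d], so that a clamped value also moves by at most
     the modulus [d] of the body. *)
  exists (Num.min d (Num.min da db)) => [|w w' e bw bw' [gw gP] [gw' gP'] ww'].
    by rewrite !lt_min d0 da0.
  have [cP /(close_on_min sa sb)[ca cb]] := close_on_min (fun _ => id) (fun _ => id) ww'.
  have {}ca := Ha _ _ (in_box_sub sa bw) (in_box_sub sa bw') ca.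
  have {}cb := Hb _ _ (in_box_sub sb bw) (in_box_sub sb bw') cb.
  have step v v' : tval w a <= v <= tval w b -> tval w' a <= v' <= tval w' b ->
      `|v - v'| <= d -> bsat (above s e) P (upd w y v) ->
      bsat (above s (e + k)) P (upd w' y v').
    move=> vab vab' vv'; apply: H.
    - exact: in_box_quant IP bw vab.
    - exact: in_box_quant IP bw' vab'.
    - exact: gP.
    - exact: gP'.
    - exact: close_on_upd sP cP vv'.
  case: q {IP bw bw' sa sb sP cP ww'} step => step /=.
    (* A universal quantifier clamps backwards, from the interval at [w'] into the one at [w]; an
       existential one clamps its witness forwards. *)
    move=> h v' vab'; rewrite distrC in ca; rewrite distrC in cb.
    have [v vab] := clamp vab' gw ca cb; rewrite distrC => vv'.
    exact: step vab vab' vv' (h v vab).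
  move=> [v vab hv]; have [v' vab' vv'] := clamp vab gw' ca cb.
  by exists v' => //; exact: step vab vab' vv' hv.
Qed.

Lemma bsat_closed (R : realType) I P (s : R) (w : state R) :
  `|s| = 1 -> enclosed R I P -> in_box I (fv P) w -> genuine P w ->
  (forall e, 0 < e -> bsat (above s e) P w) -> bsat (above s 0) P w.
Proof.
move=> s1; elim: P w => [r t|P IHP Q IHQ|P IHP Q IHQ|q y a b P IH] w IP bw gw h.
- rewrite /= /above oppr0 leNgt; apply/negP => lt0.
  by have /= := h (- (s * tval w t) / 2) ltac:(lra); rewrite /above; lra.
- have [IP1 IQ] := IP; have [g1 g2] := gw; split.
    apply: IHP => // [|e e0]; last by case: (h e e0).
    by apply: in_box_sub bw => x xt; rewrite mem_cat xt.
  apply: IHQ => // [|e e0]; last by case: (h e e0).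
  by apply: in_box_sub bw => x xt; rewrite mem_cat xt orbT.
- have [IP1 IQ] := IP; have [g1 g2] := gw.
  have bP : in_box I (fv P) w by apply: in_box_sub bw => x xt; rewrite mem_cat xt.
  have bQ : in_box I (fv Q) w by apply: in_box_sub bw => x xt; rewrite mem_cat xt orbT.
  (* If the left disjunct fails at some [e1], it fails at every smaller relaxation, so the right one
     holds at [Num.min e e1] and hence at [e]. *)
  have [/IHP hP|] := pselect (forall e, 0 < e -> bsat (above s e) P w).
    by left; apply: hP.
  move=> /existsNP[e1 /not_implyP[e10 nP]]; right; apply: IHQ => // e e0.
  have [|hP|hQ] := h (Num.min e e1); first by rewrite lt_min e0.
    case: nP; apply: bsat_imp bP _ hP => // t w' _ _.
    by rewrite /above; apply: le_trans; rewrite lerN2 ge_min lexx orbT.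
  apply: bsat_imp bQ _ hQ => // t w' _ _.
  by rewrite /above; apply: le_trans; rewrite lerN2 ge_min lexx.
- have [yab _ _ _ IP'] := IP; have [gab gP] := gw.
  case: q IP bw gw h => IP bw gw h.
    move=> v vab; have bv := in_box_quant IP bw vab.
    by apply: (IH _ IP' bv (gP v vab)) => e /h /(_ v vab).
  have /choice[v vP] : forall n : nat, exists v, tval w a <= v <= tval w b /\
      bsat (above s n.+1%:R^-1) P (upd w y v).
    by move=> n; have [|v] := h n.+1%:R^-1; [rewrite invr_gt0 ltr0n | exists v].
  have [c cab cP] := segment_cluster (fun n => (vP n).1).
  exists c => //; apply: (IH _ IP' (in_box_quant IP bw cab) (gP c cab)) => e e0.
  (* One half of [e] absorbs the relaxation [1 / (n + 1)] of the witness [v n]; the other half pays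
     for moving from [v n] to the cluster point [c]. *)
  have e20 : 0 < e / 2 by lra.
  have [d d0 H] := bsat_shift s1 IP' e20.
  have [N NP] := inv_succ_lt e20.
  have [n /NP ne vc] := cP d d0 N; have [vab hv] := vP n.
  have : bsat (above s (e / 2)) P (upd w y (v n)).
    apply: (bsat_imp IP' (in_box_quant IP bw vab) _ hv) => t w' _ _.
    by rewrite /above; apply: le_trans; rewrite lerN2 ltW.
  have := H (upd w y (v n)) (upd w y c) (e / 2); rewrite -splitr; apply.
  - exact: in_box_quant IP bw vab.
  - exact: in_box_quant IP bw cab.
  - exact: gP.
  - exact: gP.
  - move=> x _; rewrite /upd; case: eqP => _; first exact: ltW.
    by rewrite subrr normr0 ltW.
Qed.

(** * Consequences of the normal form and of distinct binders *)

Fixpoint pure (r : cmp) (P : bfml) : Prop :=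
  match P with
  | BAtom r' _ => r' = r
  | BAnd P Q | BOr P Q => pure r P /\ pure r Q
  | BQ _ _ _ _ P => pure r P
  end.

Fixpoint bounds_scoped (P : bfml) : Prop :=
  match P with
  | BAtom _ _ => True
  | BAnd P Q | BOr P Q => bounds_scoped P /\ bounds_scoped Q
  | BQ _ y a b P => y \notin tvars a ++ tvars b /\ bounds_scoped P
  end.

Lemma cnf_quantifier_free (R : realType) r P : cnf r P ->
  [/\ pure r P, bounds_scoped P, ranges P = [::] & forall w : state R, genuine P w].
Proof.
elim=> {P} [P|P Q _ [? ? /= -> ?] _ [? ? -> ?]]; last by [].
by elim=> {P} [t|P Q _ [? ? /= -> ?] _ [? ? -> ?]].
Qed.

Lemma normal_form_pure (R : realType) r (Pre : state R -> Prop) P :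
  normal_form r Pre P -> pure r P /\ bounds_scoped P.
Proof.
by elim=> {Pre P} [Pre P /(cnf_quantifier_free R)[]|Pre q y a b P _ _ yab _ _ []].
Qed.

Definition distinct_binders (P : bfml) : Prop :=
  uniq (unzip1 (ranges P)) /\ disjoint_vars (unzip1 (ranges P)) (fv P).

(** The variables of [a] and [b] are free in the quantified formula, hence distinct from all of its
    binders. *)
Lemma distinct_binders_quant q y a b P :
  y \notin tvars a ++ tvars b -> distinct_binders (BQ q y a b P) ->
  [/\ distinct_binders P, y \notin unzip1 (ranges P) &
      forall z, z \in tvars a ++ tvars b -> z \notin y :: unzip1 (ranges P)].
Proof.
move=> yab; have [sa sb sP] := fv_quant_sub q P yab.
move=> [/andP[yP uP] /hasPn dP]; split=> //.
  split=> //; apply/hasPn => z zP; have := sP z zP; rewrite in_cons.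
  by move=> /predU1P[->//|/dP]; rewrite /= in_cons negb_or => /andP[].
by move=> z; rewrite mem_cat => /orP[/sa/dP|/sb/dP].
Qed.

(** The induction needs [Pre] to survive updates of the binders. The constraint on [y] added under a
    quantifier does so, because neither [y] nor a variable of its bounds is bound again inside. *)
Lemma normal_form_genuine (R : realType) r (Pre : state R -> Prop) P :
  normal_form r Pre P -> distinct_binders P ->
  (forall w y v, y \in unzip1 (ranges P) -> Pre w -> Pre (upd w y v)) ->
  forall w, Pre w -> genuine P w.
Proof.
elim=> {Pre P} [Pre P /(cnf_quantifier_free R)[]//|Pre q y a b P _ _ yab ab _ IH].
move=> cl stable w Prew; have [clP yP abP] := distinct_binders_quant yab cl.
have upda v z (w' : state R) : z \in y :: unzip1 (ranges P) ->
    tval (upd w' z v) a = tval w' a /\ tval (upd w' z v) b = tval w' b.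
  move=> zP; have : z \notin tvars a ++ tvars b by apply: contraL zP => /abP.
  by rewrite mem_cat negb_or => /andP[za zb]; rewrite !tval_upd.
split=> [|v vab]; first exact: ab.
apply: IH => // [w' z v' zP [Prew' w'ab]|].
  have zyP : z \in y :: unzip1 (ranges P) by rewrite in_cons zP orbT.
  split; first exact: stable.
  have [-> ->] := upda v' z w' zyP; rewrite /upd; case: eqP => // yz.
  by rewrite yz zP in yP.
have [-> ->] := upda v y w (mem_head _ _).
split; first by apply: stable => //; exact: mem_head.
by rewrite /upd eqxx.
Qed.

Lemma enclosure_term (R : realType) Q I t : enclosure R Q I ->
  {subset subterms t <= terms Q} -> term_enclosure R I t.
Proof.
move=> [hc _ hadd hmul happ] st; split.
- by move=> c /st /hc.
- by move=> t1 t2 /st /hadd h x y hx hy; apply: h; exists x => //; exists y.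
- by move=> t1 t2 /st /hmul h x y hx hy; apply: h; exists x => //; exists y.
- move=> f e /st /happ h x z hx hz; apply: h; exists (interp f x); first by exists x.
  by exists z.
Qed.

Lemma enclosure_enclosed (R : realType) Q I P : enclosure R Q I ->
  {subset terms P <= terms Q} -> {subset ranges P <= ranges Q} ->
  bounds_scoped P -> enclosed R I P.
Proof.
move=> QI; have [_ hr _ _ _] := QI.
elim: P => [r t|P IHP Q' IHQ|P IHP Q' IHQ|q y a b P IH] /= st sr.
- by move=> _; apply: enclosure_term QI _ => u ut; apply: st; rewrite in_cons ut orbT.
- move=> [bP bQ]; split; [apply: IHP | apply: IHQ] => //;
  by move=> u uP; (apply: st || apply: sr); rewrite mem_cat uP ?orbT.
- move=> [bP bQ]; split; [apply: IHP | apply: IHQ] => //;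
  by move=> u uP; (apply: st || apply: sr); rewrite mem_cat uP ?orbT.
- move=> [yab bP]; split=> //.
  + by apply: enclosure_term QI _ => u ut; apply: st; rewrite in_cons mem_cat ut orbT.
  + by apply: enclosure_term QI _ => u ut; apply: st; rewrite in_cons !mem_cat ut !orbT.
  + by apply: hr; apply: sr; exact: mem_head.
  + apply: IH => // u uP; first by apply: st; rewrite in_cons !mem_cat uP !orbT.
    by apply: sr; rewrite in_cons uP orbT.
Qed.

(** * Existence of enclosures *)

Lemma interval_addition (R : realType) : exists f : IQ * IQ -> IQ,
  forall p x y, itv R p.1 x -> itv R p.2 y -> itv R (f p) (x + y).
Proof.
suff /choice[f fP] : forall p : IQ * IQ, exists k, forall x y : R,
    itv R p.1 x -> itv R p.2 y -> itv R k (x + y) by exists f.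
move=> p; have [k kP] := segment_in_itv
  (ratr (lo p.1) + ratr (lo p.2) : R) (ratr (hi p.1) + ratr (hi p.2)).
by exists k => x y /andP[? ?] /andP[? ?]; apply: kP; rewrite !lerD.
Qed.

Lemma interval_multiplication (R : realType) : exists f : IQ * IQ -> IQ,
  forall p x y, itv R p.1 x -> itv R p.2 y -> itv R (f p) (x * y).
Proof.
suff /choice[f fP] : forall p : IQ * IQ, exists k, forall x y : R,
    itv R p.1 x -> itv R p.2 y -> itv R k (x * y) by exists f.
move=> p; have [M1 _ M1P] := itv_bounded R p.1.
have [M2 _ M2P] := itv_bounded R p.2.
have [k kP] := segment_in_itv (- (M1 * M2)) (M1 * M2).
exists k => x y /M1P h1 /M2P h2; apply: kP.
by rewrite -ler_norml normrM ler_pM.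
Qed.

(** Interval evaluation from intervals [J] of the variables. With sound operations it is an
    enclosure as soon as [J] respects the bounds of the quantifiers. *)
Fixpoint interval_value (cst : rat -> IQ) (add mul : IQ * IQ -> IQ)
    (app : ivp * IQ -> IQ) (J : nat -> IQ) (t : term) : IQ :=
  match t with
  | TVar x => J x
  | TCst c => cst c
  | TAdd t1 t2 => add (interval_value cst add mul app J t1,
                       interval_value cst add mul app J t2)
  | TMul t1 t2 => mul (interval_value cst add mul app J t1,
                       interval_value cst add mul app J t2)
  | TApp f e => app (f, interval_value cst add mul app J e)
  end.

Lemma interval_value_ext cst add mul app J J' t : {in tvars t, J =1 J'} ->
  interval_value cst add mul app J t = interval_value cst add mul app J' t.
Proof.
elim: t => [x|c|t1 IH1 t2 IH2|t1 IH1 t2 IH2|f e IH] //= JJ'.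
- by apply: JJ'; rewrite inE.
- by rewrite IH1 ?IH2 // => x xt; apply: JJ'; rewrite mem_cat xt ?orbT.
- by rewrite IH1 ?IH2 // => x xt; apply: JJ'; rewrite mem_cat xt ?orbT.
- by rewrite IH.
Qed.

Lemma interval_hull (R : realType) (i j : IQ) :
  exists k, itv R i `|` itv R j `<=` itv R k.
Proof.
have [k kP] := segment_in_itv (Num.min (ratr (lo i)) (ratr (lo j)) : R)
  (Num.max (ratr (hi i)) (ratr (hi j))).
exists k => x [|] /andP[lx xh]; apply: kP;
by rewrite ge_min le_max lx xh ?orbT.
Qed.

(** Binders are treated from the outside in: [y] receives a hull of the values of its bounds, and
    the choices for inner binders change neither these values nor the interval of [y]. *)
Lemma range_intervals (R : realType) cst add mul app r (Pre : state R -> Prop) P :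
  normal_form r Pre P -> distinct_binders P -> forall J, exists J',
    (forall x, x \notin unzip1 (ranges P) -> J' x = J x) /\
    (forall y a b, (y, (a, b)) \in ranges P ->
       itv R (interval_value cst add mul app J' a) `|`
       itv R (interval_value cst add mul app J' b) `<=` itv R (J' y)).
Proof.
elim=> {Pre P} [Pre P /(cnf_quantifier_free R)[_ _ -> _] _ J|].
  by exists J.
move=> Pre q y a b P _ _ yab _ _ IH cl J; have [clP yP abP] := distinct_binders_quant yab cl.
have [k kP] := interval_hull R (interval_value cst add mul app J a)
  (interval_value cst add mul app J b).
have [J' [J'out J'in]] := IH clP (upd J y k).
have out x : x \notin y :: unzip1 (ranges P) -> J' x = J x.
  rewrite in_cons negb_or => /andP[xy xP].
  by rewrite J'out // /upd (negPf xy).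
exists J'; split; first exact: out.
move=> y' a' b'; rewrite in_cons => /predU1P[[-> -> ->]|]; last exact: J'in.
rewrite (J'out y yP) /upd eqxx.
by rewrite !(@interval_value_ext _ _ _ _ J' J) // => x xt; apply: out; apply: abP;
  rewrite mem_cat xt ?orbT.
Qed.

Lemma enclosure_exists (R : realType) r (Pre : state R -> Prop) P D :
  normal_form r Pre P -> distinct_binders P -> exists I, enclosure R P I /\ extends P I D.
Proof.
move=> nP cl; have [add addP] := interval_addition R.
have [mul mulP] := interval_multiplication R.
have /choice[cst cstP] : forall c, exists k, itv R k (ratr c).
  move=> c; have [k kP] := segment_in_itv (ratr c : R) (ratr c).
  by exists k; apply: kP; rewrite lexx.
have /choice[app appP] : forall p : ivp * IQ, exists k, forall x z,
    itv R p.2 x -> -1 <= z <= 1 -> itv R k (interp p.1 x + z).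
  by move=> p; exact: (continuous_image_in_itv _ (@interp_continuous R p.1)).
have [J [Jout Jin]] := range_intervals cst add mul app nP cl D.
exists (interval_value cst add mul app J); split; last first.
  move=> x xP; apply: Jout; have [_ /hasPn] := cl; exact.
split=> //=.
- by move=> t1 t2 _ _ [x hx [y hy <-]]; exact: addP.
- by move=> t1 t2 _ _ [x hx [y hy <-]]; exact: mulP.
- by move=> f e _ _ [_ [x hx <-] [z hz <-]]; exact: (appP (f, _)).
Qed.

(** * Admissible sequences of approximations *)

(** Accuracy [d / 2] is asked for because the supremum in [approx_norm] has to be strictly below
    [d]. [FTrue] is a default for nonpositive [d] and for terms that are not applications. *)
Lemma approximations_exist (R : realType) (I : enclosure_map) :
  exists F : rat -> Defs.approximation, forall d f e, 0 < d ->
    defines_function R (F d (TApp f e)) /\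
    forall y : R, itv R (I e) y ->
      `|fun_of (F d (TApp f e)) y - interp f y| <= ratr d / 2.
Proof.
have /choice[G GP] : forall p : rat * ivp * IQ, exists A, 0 < p.1.1 ->
    defines_function R A /\ forall y : R, itv R p.2 y ->
      `|fun_of A y - interp p.1.2 y| <= ratr p.1.1 / 2.
  move=> [[d f] i]; have [d0|] := boolP (0 < d); last by exists FTrue.
  have d20 : 0 < ratr d / 2 :> R by rewrite divr_gt0 // ltr0q.
  have [s sP] := step_approximation i (@interp_continuous R f) d20.
  exists (step_fml s) => _; split; first exact: step_fml_defines.
  by move=> y /sP; rewrite fun_of_step.
exists (fun d t => if t is TApp f e then G (d, f, I e) else FTrue) => d f e.
by move=> /(GP (d, f, I e)).
Qed.

(** Starting at [1 / 3] keeps every member below [1 / 2]. *)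
Definition accuracy (n : nat) : rat := n.+3%:R^-1.

Lemma accuracy_gt0 n : 0 < accuracy n.
Proof. by rewrite /accuracy invr_gt0 ltr0n. Qed.

Lemma accuracy_lt_half n : accuracy n < 1 / 2.
Proof. by rewrite /accuracy div1r ltf_pV2 ?posrE ?ltr0n // ltr_nat. Qed.

Lemma ratr_accuracy (R : realType) n : ratr (accuracy n) = n.+3%:R^-1 :> R.
Proof. by rewrite /accuracy fmorphV /= ratr_nat. Qed.

Lemma accuracy_le (R : realType) (b : R) : 0 < b ->
  exists N, forall n, (N <= n)%N -> ratr (accuracy n) <= b.
Proof.
move=> /inv_succ_lt[N NP]; exists N => n Nn; rewrite ratr_accuracy ltW //.
by apply: NP; rewrite (leq_trans Nn) // -addn2 leq_addr.
Qed.

Lemma sequence_admissible (R : realType) P I (F : rat -> Defs.approximation) :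
  (forall d f e, 0 < d -> defines_function R (F d (TApp f e)) /\
    forall y : R, itv R (I e) y ->
      `|fun_of (F d (TApp f e)) y - interp f y| <= ratr d / 2) ->
  admissible_sequence R P I accuracy F.
Proof.
move=> FP; split=> [n|].
  have d0 := accuracy_gt0 n; split; first by rewrite d0 accuracy_lt_half.
    by move=> f e _; exact: (FP _ _ _ d0).1.
  have r0 : 0 < ratr (accuracy n) :> R by rewrite ltr0q.
  rewrite /approx_norm; apply: bigmax_lt => [|[f e] _]; first by rewrite lte_fin.
  apply: (@le_lt_trans _ _ (ratr (accuracy n) / 2)%:E); last by rewrite lte_fin; lra.
  by apply: ge_ereal_sup => _ [y yI <-]; rewrite lee_fin; apply: (FP _ _ _ d0).2.
apply/cvgr0Pnorm_le => e /accuracy_le[N NP]; exists N => // n /NP.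
by rewrite /= ger0_norm // ler0q ltW // accuracy_gt0.
Qed.

(** * Exact and perturbed formulas as instances of [bsat] *)

Lemma sat_bounded_quant (R : realType) q y a b X (w : state R) :
  y \notin tvars a ++ tvars b ->
  sat w (bounded_quant q y (in_bounds y a b) X) <->
  match q with
  | QAll => forall v, tval w a <= v <= tval w b -> sat (upd w y v) X
  | QEx => exists2 v, tval w a <= v <= tval w b & sat (upd w y v) X
  end.
Proof.
rewrite mem_cat negb_or => /andP[ya yb].
have E v : sat (upd w y v) (in_bounds y a b) <-> tval w a <= v <= tval w b.
  by rewrite /= !tval_upd // /upd eqxx (rwP andP).
case: q; split=> /=.
- by move=> h v /E; exact: h.
- by move=> h v /E; exact: h.
- by move=> [v [/E vab hv]]; exists v.
- by move=> [v vab hv]; exists v; split=> //; apply/E.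
Qed.

Lemma sat_bsat (R : realType) r P (w : state R) : pure r P -> bounds_scoped P ->
  sat w P <-> bsat (fun t w => cmp_sem r (tval w t) 0) P w.
Proof.
elim: P w => [r' t|P IHP Q IHQ|P IHP Q IHQ|q y a b P IH] w.
- by move=> /= -> _; rewrite rmorph0.
- by move=> [pP pQ] [bP bQ] /=; rewrite (IHP w) // (IHQ w).
- by move=> [pP pQ] [bP bQ] /=; rewrite (IHP w) // (IHQ w).
- move=> /= pP [yab bP]; rewrite sat_bounded_quant //; case: q; split.
  + by move=> h v /h /IH; apply.
  + by move=> h v /h /IH; apply.
  + by move=> [v vab /IH hv]; exists v => //; exact: hv.
  + by move=> [v vab /IH hv]; exists v => //; exact: hv.
Qed.

Lemma sat_perturb_bsat (R : realType) q F d r P (w : state R) :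
  pure r P -> bounds_scoped P ->
  sat w (perturb q F d P) <->
  bsat (fun t w => sat w (perturb_atom q d r (size (tsyms t)) F t)) P w.
Proof.
elim: P w => [r' t|P IHP Q IHQ|P IHP Q IHQ|q' y a b P IH] w.
- by move=> /= ->.
- by move=> [pP pQ] [bP bQ] /=; rewrite (IHP w) // (IHQ w).
- by move=> [pP pQ] [bP bQ] /=; rewrite (IHP w) // (IHQ w).
- move=> /= pP [yab bP]; rewrite sat_bounded_quant //; case: q'; split.
  + by move=> h v /h /IH; apply.
  + by move=> h v /h /IH; apply.
  + by move=> [v vab /IH hv]; exists v => //; exact: hv.
  + by move=> [v vab /IH hv]; exists v => //; exact: hv.
Qed.

(** * Uniform bounds over all atoms, and robustness *)

Lemma enclosed_atoms (R : realType) I P t :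
  enclosed R I P -> t \in atoms P -> term_enclosure R I t.
Proof.
elim: P => [r u|P IHP Q IHQ|P IHP Q IHQ|q y a b P IH] /=.
- by move=> uI; rewrite mem_seq1 => /eqP->.
- by move=> [/IHP hP /IHQ hQ]; rewrite mem_cat => /orP[/hP|/hQ].
- by move=> [/IHP hP /IHQ hQ]; rewrite mem_cat => /orP[/hP|/hQ].
- by case.
Qed.

Lemma reach_close_seq (R : realType) I (s : seq term) (c : R) :
  (forall t, t \in s -> term_enclosure R I t) -> 0 < c ->
  exists2 b : R, 0 < b & forall t, t \in s -> forall (d : rat) F (w : state R) z,
    (ratr d : R) <= 1 / 2 -> ratr d <= b -> accurate R I d F t ->
    in_box I (tvars t) w -> reach d (size (tsyms t)) F t w z ->
    `|z - tval w t| <= c.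
Proof.
move=> + c0; elim: s => [|u s IH] Is; first by exists 1.
have [b b0 H] := IH (fun t ts => Is t (mem_behead (s := u :: s) ts)).
have [b' b'0 H'] := reach_close (size (tsyms u)) (Is u (mem_head u s)) c0.
exists (Num.min b b') => [|t]; first by rewrite lt_min b0.
rewrite in_cons => /predU1P[->|ts] d F w z d2; rewrite le_min => /andP[db db'].
  exact: H'.
exact: H.
Qed.

(** If every [e > 0] fails, the dual holds with atoms [tval w t <= e], that is [above (-1) e], for
    all [e > 0]. By [bsat_closed] it then holds with [tval w t <= 0], which refutes the
    hypothesis. *)
Lemma open_bsat (R : realType) I P (w : state R) :
  enclosed R I P -> in_box I (fv P) w -> genuine P w ->
  bsat (fun t w => 0 < tval w t) P w ->
  exists2 e : R, 0 < e & bsat (fun t w => e < tval w t) P w.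
Proof.
move=> IP bw gw h; apply: contrapT => Ne.
have ID := enclosed_dual IP; have bD : in_box I (fv (dual P)) w by rewrite fv_dual.
suff : bsat (fun t w => ~ 0 < tval w t) (dual P) w by move=> /bsat_dual.
have s1 : `|-1| = 1 :> R by rewrite normrN1.
apply: (bsat_imp ID bD _ (bsat_closed s1 ID bD (genuine_dual gw) _)).
  by move=> t w' _ _; rewrite /above => ? ?; lra.
move=> e e0; have /bsat_dual : ~ bsat (fun t w => e < tval w t) P w.
  by move=> he; apply: Ne; exists e.
apply: (bsat_imp ID bD) => t w' _ _ /negP; rewrite -leNgt /above; lra.
Qed.

Theorem theorem5p9 (R : realType) (r : cmp) (hr : r = Ge \/ r = Gt)
    (varphi : bfml) (hvarphi : bounded_pure R r varphi) :
  (r = Gt -> forall D : domain, forall_robust R varphi D) /\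
  (r = Ge -> forall D : domain, exists_robust R varphi D).
Proof.
have [nP uP dP _] := hvarphi; have cl : distinct_binders varphi by split.
have [pP sP] := normal_form_pure nP.
have gP (w : state R) : genuine varphi w by apply: (normal_form_genuine nP cl).
(* Both claims reduce to equivalences at each state of the box, with one enclosure and one sequence
   serving both relations. *)
suff main D : exists Ie F, [/\ enclosure R varphi Ie, extends varphi Ie D,
    admissible_sequence R varphi Ie accuracy F &
    forall w : state R, in_box Ie (fv varphi) w ->
      (r = Gt -> sat w varphi <->
        exists n, sat w (perturb QAll (F (accuracy n)) (accuracy n) varphi)) /\
      (r = Ge -> sat w varphi <->
        forall n, sat w (perturb QEx (F (accuracy n)) (accuracy n) varphi))].
  split=> rE D; have [Ie [F [eI xI aF sF]]] := main D;
    exists Ie, accuracy, F; split=> //; apply/seteqP; split=> w.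
  - move=> [wD wP]; have bw : in_box Ie (fv varphi) w.
      by move=> x xP; rewrite xI //; exact: wD.
    by have [/(_ rE)[/(_ wP)[n wn] _] _] := sF w bw; exists n.
  - move=> [n _ [wD wn]]; have bw : in_box Ie (fv varphi) w.
      by move=> x xP; rewrite xI //; exact: wD.
    by have [/(_ rE)[_ h] _] := sF w bw; split=> //; apply: h; exists n.
  - move=> [wD wP] n _; have bw : in_box Ie (fv varphi) w.
      by move=> x xP; rewrite xI //; exact: wD.
    by have [_ /(_ rE)[/(_ wP n) wn _]] := sF w bw; split.
  (* The box constraint is the same for all indices, so it is read off the member with index 0. *)
  - move=> h; have [wD _] := h 0%N Logic.I; have bw : in_box Ie (fv varphi) w.
      by move=> x xP; rewrite xI //; exact: wD.
    have [_ /(_ rE)[_ h']] := sF w bw; split=> //; apply: h' => n.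
    by have [] := h n Logic.I.
have [Ie [eI xI]] := enclosure_exists D nP cl.
have [F FP] := approximations_exist R Ie.
have IP : enclosed R Ie varphi by exact: enclosure_enclosed eI _ _ sP.
have accF n t : accurate R Ie (accuracy n) (F (accuracy n)) t.
  move=> f e _; have [dF hF] := FP _ f e (accuracy_gt0 n); split=> // y /hF h.
  have : 0 < ratr (accuracy n) :> R by rewrite ltr0q accuracy_gt0.
  by move=> ?; apply: le_trans h _; lra.
have defF n t f e : TApp f e \in subterms t ->
    defines_function R (F (accuracy n) (TApp f e)).
  by move=> _; exact: (FP _ _ _ (accuracy_gt0 n)).1.
have half n : (ratr (accuracy n) : R) <= 1 / 2.
  have := accuracy_lt_half n; rewrite -(ltr_rat R) fmorph_div /= rmorph1 ratr_nat.
  exact: ltW.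
have fine_accuracy (e : R) : 0 < e -> exists n, forall t (w : state R) z,
    t \in atoms varphi -> in_box Ie (tvars t) w ->
    reach (accuracy n) (size (tsyms t)) (F (accuracy n)) t w z ->
    `|z - tval w t| <= e.
  move=> e0.
  have [b b0 H] := reach_close_seq (fun t => @enclosed_atoms R Ie varphi t IP) e0.
  have [N NP] := accuracy_le b0; exists N => t w z tP bw.
  exact: H tP _ _ _ _ (half N) (NP N (leqnn N)) (accF N t) bw.
have exact_reach n t (w : state R) : t \in atoms varphi -> in_box Ie (tvars t) w ->
    reach (accuracy n) (size (tsyms t)) (F (accuracy n)) t w (tval w t).
  by move=> tP; apply: reach_tval; first exact: enclosed_atoms tP.
exists Ie, F; split=> //; first exact: sequence_admissible.
move=> w bw; split=> rE; subst r; rewrite (sat_bsat w pP sP) /=.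
(* A strict formula holds with a margin [e], which absorbs the perturbation at a fine enough
   accuracy. Conversely the exact value is among the perturbed ones. *)
- split=> [/(open_bsat IP bw (gP w))[e e0 he]|[n]].
    have [n nP'] := fine_accuracy e e0; exists n.
    apply/(sat_perturb_bsat _ _ _ w pP sP); apply: (bsat_imp IP bw _ he).
    move=> t w' tP bw' et; apply/(sat_perturb_atom _ _ _ _ _ (@defF n t)) => z.
    move=> /(nP' t w' z tP bw').
    by rewrite /= ler_norml => /andP[? _]; lra.
  move=> /(sat_perturb_bsat _ _ _ w pP sP); apply: (bsat_imp IP bw) => t w' tP bw'.
  by move=> /(sat_perturb_atom _ _ _ _ _ (@defF n t)); apply; exact: exact_reach.
- split=> [he n|h].
    apply/(sat_perturb_bsat _ _ _ w pP sP); apply: (bsat_imp IP bw _ he) => t w' tP bw' t0.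
    apply/(sat_perturb_atom _ _ _ _ _ (@defF n t)); exists (tval w' t) => //.
    exact: exact_reach.
  (* At an accuracy that is fine for [e], a perturbed value [z >= 0] forces the exact one to be at
     least [- e]; closedness then lets [e] tend to 0. *)
  have : bsat (above 1 0) varphi w.
    apply: (bsat_closed (normr1 R) IP bw (gP w)) => e e0.
    have [n nP'] := fine_accuracy e e0.
    have /(sat_perturb_bsat _ _ _ w pP sP) := h n.
    apply: (bsat_imp IP bw) => t w' tP bw' /(sat_perturb_atom _ _ _ _ _ (@defF n t))[z].
    move=> /(nP' t w' z tP bw'); rewrite ler_norml /above /= mul1r => /andP[_ ?] ?; lra.
  by apply: (bsat_imp IP bw) => t w' _ _; rewrite /above oppr0 mul1r.
Qed.
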